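(* Let $u_h\in V_h$ and $\bar u_h\in\bar V_h$ be the velocity components of a solution $(u_h,\bar u_h,p_h,\bar p_h)\in V_h\times\bar V_h\times Q_h\times\bar Q_h$ of the semi-discrete problem (M1)--(M4) given in the context. Then $$\nabla\cdot u_h=0\qquad \forall x\in K,\ \forall K\in\mathcal T,$$ and $$\llbracket u_h\rrbracket=0\quad \forall x\in F,\ \forall F\in\mathcal F_I,\qquad\qquad u_h\cdot n=\bar u_h\cdot n\quad \forall x\in F,\ \forall F\in\mathcal F_B.$$
   Context: Setting. $\Omega\subset\mathbb R^d$ is a polygonal ($d=2$) or polyhedral ($d=3$) domain with outward unit normal $n$; $I=(0,t_N]$ is the time interval; $\partial\Omega=\Gamma_D\cup\Gamma_N$ with $\Gamma_D\cap\Gamma_N=\emptyset$; $\nu>0$ is the kinematic viscosity; $f$ is a forcing term with $f\in[L^2(\Omega)]^d$ and $h\in[L^2(\Gamma_N)]^d$ is boundary data (at each time). $\mathcal T=\{K\}$ is a triangulation of $\Omega$ into non-overlapping simplices $K$; $n$ also denotes the outward unit normal on $\partial K$; $h_K$ is the size (diameter) of $K$. Two adjacent cells $K^+,K^-$ share an interior facet $F=\partial K^+\cap\partial K^-$; a facet of $\partial K$ lying on $\partial\Omega$ is a boundary facet. $\mathcal F_I$, $\mathcal F_B$ are the sets of interior and boundary facets, $\mathcal F=\mathcal F_I\cup\mathcal F_B$. On an interior facet the jump is $\llbracket a\rrbracket=a^+\cdot n^++a^-\cdot n^-$, where $a^\pm$ are the traces of $a$ from $K^\pm$ and $n^\pm$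 is the outward unit normal on $\partial K^\pm$. Spaces. $P_l(D)$ denotes polynomials of degree (at most) $l$ on $D$, and $k\ge2$ is an integer. $V_h=\{v_h\in[L^2(\mathcal T)]^d: v_h|_K\in[P_k(K)]^d\ \forall K\in\mathcal T\}$; $\bar V_h=\{\bar v_h\in[L^2(\mathcal F)]^d:\bar v_h|_F\in[P_k(F)]^d\ \forall F\in\mathcal F,\ \bar v_h=0\text{ on }\Gamma_D\}$; $Q_h=\{q_h\in L^2(\mathcal T): q_h|_K\in P_{k-1}(K)\ \forall K\in\mathcal T\}$; $\bar Q_h=\{\bar q_h\in L^2(\mathcal F):\bar q_h|_F\in P_k(F)\ \forall F\in\mathcal F\}$. Functions in $\bar V_h,\bar Q_h$ live only on facets and are single-valued there; functions in $V_h,Q_h$ may be discontinuous across facets, and in integrals over $\partial K$ their traces from inside $K$ are used. Fluxes. $(a\otimes b)_{ij}=a_ib_j$, $(\nabla u)_{ij}=\partial u_i/\partial x_j$, $\mathbb I$ is the identity tensor. $\sigma_h=\sigma_{a,h}+\sigma_{d,h}$ with $\sigma_{a,h}=u_h\otimes u_h$ and $\sigma_{d,h}=p_h\mathbb I-\nu\nabla u_h$. The numerical flux is $\hat\sigma_h=\hat\sigma_{a,h}+\hat\sigma_{d,h}$ with $\hat\sigma_{a,h}=\sigma_{a,h}+(\bar u_h-u_h)\otimes\lambda u_h$ and $\hat\sigma_{d,h}=\bar p_h\mathbb I-\nu\nabla u_h-\frac{\nu\alpha}{h_K}(\bar u_h-u_h)\otimes n$, where $\lambda=1$ on parts of cell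 boundaries with $u_h\cdot n<0$, $\lambda=0$ where $u_h\cdot n\ge0$, and $\alpha>0$ is a penalty parameter. Semi-discrete problem: at each time in $I$, find $(u_h,\bar u_h,p_h,\bar p_h)\in V_h\times\bar V_h\times Q_h\times\bar Q_h$ such that (M1) $0=\sum_K\int_K u_h\cdot\nabla q_h\,dx-\sum_K\int_{\partial K}u_h\cdot n\,q_h\,ds$ for all $q_h\in Q_h$; (M2) $0=\sum_K\int_{\partial K}u_h\cdot n\,\bar q_h\,ds-\int_{\partial\Omega}\bar u_h\cdot n\,\bar q_h\,ds$ for all $\bar q_h\in\bar Q_h$; (M3) $\int_\Omega f\cdot v_h\,dx=\int_\Omega\partial_tu_h\cdot v_h\,dx-\sum_K\int_K\sigma_h:\nabla v_h\,dx+\sum_K\int_{\partial K}\hat\sigma_h:(v_h\otimes n)\,ds+\sum_K\int_{\partial K}\nu\,((\bar u_h-u_h)\otimes n):\nabla v_h\,ds$ for all $v_h\in V_h$; (M4) $\int_{\Gamma_N}h\cdot\bar v_h\,ds=\sum_K\int_{\partial K}\hat\sigma_h:(\bar v_h\otimes n)\,ds-\int_{\Gamma_N}(1-\lambda)(\bar u_h\cdot n)\,\bar u_h\cdot\bar v_h\,ds$ for all $\bar v_h\in\bar V_h$. The solution is understood to depend on time with $u_h$ differentiable in time. *)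

(* Defs.v *)
From HB Require Import structures.
From mathcomp Require Import all_boot all_order all_algebra.
From mathcomp Require Import all_classical all_reals all_analysis.
From mathcomp.multinomials Require Import (coercions, canonicals) mpoly.

Set Implicit Arguments.
Unset Strict Implicit.
Unset Printing Implicit Defensive.

Import Order.TTheory GRing.Theory Num.Theory.
Import numFieldNormedType.Exports.

Local Open Scope classical_set_scope.
Local Open Scope ring_scope.

Section lebesgue_tuple.
Context (R : realType).
Local Notation RR := (measurableTypeR R).

Definition cons_tuple n (z : n.-tuple RR * RR) : n.+1.-tuple RR :=
  [the n.+1.-tuple RR of z.2 :: z.1].

Lemma measurable_cons_tuple n : measurable_fun [set: _] (@cons_tuple n).
Proof. by apply: measurable_cons; [exact: measurable_snd|exact: measurable_fst]. Qed.

(* n-dimensional Lebesgue measure, as an iterated product of the measure on R.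
   The second factor of \x must be sigma-finite, hence the swap in cons_tuple. *)
Fixpoint lebesgue_tuple n : {measure set (n.-tuple RR) -> \bar R} :=
  match n with
  | 0 => [the {measure set _ -> \bar R} of dirac [tuple]]
  | m.+1 => measure_function_pushforward__canonical__measure_function_Measure
      [the {measure set _ -> \bar R} of
        (lebesgue_tuple m \x @lebesgue_measure R)%E]
      (@measurable_cons_tuple m)
  end.

Definition vec_of n (t : n.-tuple RR) : 'rV[R]_n := \row_i tnth t i.

End lebesgue_tuple.

Section euclidean.
Context (R : realType) (d : nat).
Implicit Types (x y a b : 'rV[R]_d) (A B : 'M[R]_d) (D : set 'rV[R]_d).

(* The library norm on 'rV[R]_d is the sup norm: it is used for the topology
   only, Euclidean quantities go through dot. *)
Definition dot x y : R := \sum_i x 0 i * y 0 i.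

Definition ddot A B : R := \sum_i \sum_j A i j * B i j.

Definition outer a b : 'M[R]_d := \matrix_(i, j) (a 0 i * b 0 j).

Definition diameter D : R :=
  sup [set Num.sqrt (dot (x - y) (x - y)) | x in D & y in D].

Definition volume_integral D (g : 'rV[R]_d -> R) : R :=
  \int[lebesgue_tuple R d]_(t in [set t | D (vec_of t)]) g (vec_of t).

Definition partial (j : 'I_d) (g : 'rV[R]_d -> R) x : R :=
  'D_(delta_mx 0 j) g x.

Definition grad (g : 'rV[R]_d -> R) x : 'rV[R]_d := \row_j partial j g x.

Definition vgrad (g : 'rV[R]_d -> 'rV[R]_d) x : 'M[R]_d :=
  \matrix_(i, j) partial j (fun y => g y 0 i) x.

Definition divergence (g : 'rV[R]_d -> 'rV[R]_d) x : R :=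
  \sum_i partial i (fun y => g y 0 i) x.

Definition poly_on l D (g : 'rV[R]_d -> R) : Prop :=
  exists2 p : mpoly.mpoly d R,
    (mpoly.msize p <= l.+1)%N &
    forall x, D x -> g x = mpoly.meval (fun i => x 0 i) p.

Definition vpoly_on l D (g : 'rV[R]_d -> 'rV[R]_d) : Prop :=
  forall i, poly_on l D (fun x => g x 0 i).

Definition square_integrable D (g : 'rV[R]_d -> R) : Prop :=
  ((fun t => g (vec_of t)) \_ [set t | D (vec_of t)])
    \in Lfun (lebesgue_tuple R d) 2%:E.

End euclidean.

Section time_derivative.
Context (R : realType) (V : normedModType R).

(* Derivative relative to the interval I: one-sided at an endpoint in I. *)
Definition time_quotient (g : R -> V) (t : R) : R -> V :=
  fun s => (s - t)^-1 *: (g s - g t).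

Definition time_derivable (I : set R) (g : R -> V) (t : R) : Prop :=
  cvg (time_quotient g t @ within I t^').

Definition time_derivative (I : set R) (g : R -> V) (t : R) : V :=
  lim (time_quotient g t @ within I t^').

End time_derivative.

(* Cells and facets are represented by their sets of vertex indices. *)
Record mesh (R : realType) (d : nat) := Mesh {
  nvert : nat;
  vtx : 'I_nvert -> 'rV[R]_d;
  cells : {set {set 'I_nvert}} }.

Section mesh_geometry.
Context (R : realType) (d : nat) (M : mesh R d).

Definition simplex := {set 'I_(nvert M)}.
Implicit Types (A F K : simplex).

Definition hull A : set 'rV[R]_d :=
  [set x | exists w : 'I_(nvert M) -> R,
    [/\ forall i, 0 <= w i, forall i, i \notin A -> w i = 0,
        \sum_i w i = 1 & x = \sum_i w i *: vtx i]].

Definition vertices A : seq 'rV[R]_d := [seq vtx i | i <- enum A].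

Definition origin A : 'rV[R]_d := nth 0 (vertices A) 0.

(* For an m-simplex A, the m edge vectors issued from origin A. *)
Definition edges m A : 'M[R]_(m, d) :=
  \matrix_(j < m) (nth 0 (vertices A) j.+1 - origin A).

Definition nondegenerate K : Prop := #|K| = d.+1 /\ row_free (edges d K).

Definition covered : set 'rV[R]_d :=
  \bigcup_(K in [set K : simplex | K \in cells M]) hull K.

Definition facets_of K : {set simplex} :=
  [set F : simplex | (F \subset K) && (#|F| == d)].

Definition interior_facets : {set simplex} :=
  [set F : simplex | [exists Kp in cells M, exists Km in cells M,
     [&& Kp != Km, F == Kp :&: Km & #|F| == d]]].

Definition boundary (Omega : set 'rV[R]_d) : set 'rV[R]_d :=
  closure Omega `\` Omega°.

Definition boundary_facets (Omega : set 'rV[R]_d) : {set simplex} :=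
  [set F : simplex | [exists K in cells M, F \in facets_of K]
                     && `[< hull F `<=` boundary Omega >]].

Definition facets (Omega : set 'rV[R]_d) : {set simplex} :=
  interior_facets :|: boundary_facets Omega.

Definition outward_unit_normal K F (w : 'rV[R]_d) : Prop :=
  [/\ dot w w = 1,
      forall i j, i \in F -> j \in F -> dot w (vtx i - vtx j) = 0 &
      forall i j, i \in K :\: F -> j \in F -> dot w (vtx i - vtx j) < 0].

Definition normal K F : 'rV[R]_d := xget 0 [set w | outward_unit_normal K F w].

(* Affine parametrization of an m-simplex over the reference m-simplex. *)
Definition ref_simplex m : set (m.-tuple (measurableTypeR R)) :=
  [set t | (forall i, 0 <= tnth t i) /\ \sum_i tnth t i <= 1].

Definition param m A (t : m.-tuple (measurableTypeR R)) : 'rV[R]_d :=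
  origin A + vec_of t *m edges m A.

Definition facet_part F (G : set 'rV[R]_d) :
    set (d.-1.-tuple (measurableTypeR R)) :=
  @ref_simplex d.-1 `&` [set t | G (param F t)].

(* Surface integral over F `&` G; the surface element of the affine
   parametrization is the square root of the Gram determinant of the edges. *)
Definition facet_integral F (G : set 'rV[R]_d) (g : 'rV[R]_d -> R) : R :=
  Num.sqrt (\det (edges d.-1 F *m (edges d.-1 F)^T)) *
  \int[lebesgue_tuple R d.-1]_(t in facet_part F G) g (param F t).

Definition facet_square_integrable F (G : set 'rV[R]_d) (g : 'rV[R]_d -> R) :
    Prop :=
  ((fun t => g (param F t)) \_ (facet_part F G))
    \in Lfun (lebesgue_tuple R d.-1) 2%:E.

Definition sum_cells (g : simplex -> 'rV[R]_d -> R) : R :=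
  \sum_(K in cells M) volume_integral (hull K) (g K).

Definition sum_cell_boundaries (g : simplex -> simplex -> 'rV[R]_d -> R) : R :=
  \sum_(K in cells M) \sum_(F in facets_of K) facet_integral F setT (g K F).

(* Integral over G, a subset of the boundary of Omega: the integrand g K F uses
   the cell K to which the boundary facet F belongs. *)
Definition boundary_integral (Omega G : set 'rV[R]_d)
    (g : simplex -> simplex -> 'rV[R]_d -> R) : R :=
  \sum_(K in cells M) \sum_(F in facets_of K :&: boundary_facets Omega)
    facet_integral F G (g K F).

(* Conformity: two cells meet along the common face spanned by their common
   vertices (in particular distinct cells do not overlap). *)
Definition triangulates (Omega : set 'rV[R]_d) : Prop :=
  [/\ forall K, K \in cells M -> nondegenerate K,
      closure Omega = covered &
      forall K K', K \in cells M -> K' \in cells M ->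
        hull K `&` hull K' = hull (K :&: K')].

End mesh_geometry.

Definition polytopal_domain (R : realType) (d : nat) (Omega : set 'rV[R]_d) :
    Prop :=
  [/\ Omega !=set0, connected Omega &
      exists M : mesh R d,
        (forall K, K \in cells M -> nondegenerate K) /\ Omega = (covered M)°].

Section hybrid_method.
Context (R : realType) (d : nat) (Omega GammaD GammaN : set 'rV[R]_d).
Context (M : mesh R d) (k : nat) (nu alpha : R).

Local Notation simplex := (simplex M).
Local Notation point := 'rV[R]_d.

(* A function on the mesh is a family indexed by the cells, a function on the
   skeleton is a family indexed by the facets. *)
Definition scalar_field := simplex -> point -> R.
Definition vector_field := simplex -> point -> point.

(* A polynomial on a cell is identified with its unique extension to the whole
   space, which gives a meaning to its traces and derivatives on the boundary
   of the cell. *)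
Definition Vh (v : vector_field) : Prop :=
  forall K, K \in cells M -> vpoly_on k setT (v K).

Definition Qh (q : scalar_field) : Prop :=
  forall K, K \in cells M -> poly_on k.-1 setT (q K).

(* The condition on GammaD holds almost everywhere for the surface measure. *)
Definition Vbarh (v : vector_field) : Prop :=
  (forall F, F \in facets M Omega -> vpoly_on k (hull F) (v F)) /\
  (forall F, F \in facets M Omega ->
     (lebesgue_tuple R d.-1).-negligible
       (facet_part F GammaD `&` [set t | v F (param F t) != 0])).

Definition Qbarh (q : scalar_field) : Prop :=
  forall F, F \in facets M Omega -> poly_on k (hull F) (q F).

Section fluxes.
Variables (u ubar : vector_field) (p pbar : scalar_field).

Definition sigma (K : simplex) (x : point) : 'M[R]_d :=
  let sigma_a := outer (u K x) (u K x) in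
  let sigma_d := (p K x)%:M - nu *: vgrad (u K) x in
  sigma_a + sigma_d.

Definition lambda (K F : simplex) (x : point) : R :=
  if dot (u K x) (normal K F) < 0 then 1 else 0.

Definition sigma_hat (K F : simplex) (x : point) : 'M[R]_d :=
  let sigma_hat_a := outer (u K x) (u K x)
    + outer (ubar F x - u K x) (lambda K F x *: u K x) in
  let sigma_hat_d := (pbar F x)%:M - nu *: vgrad (u K) x
    - (nu * alpha / diameter (hull K)) *:
        outer (ubar F x - u K x) (normal K F) in
  sigma_hat_a + sigma_hat_d.

Definition mass_balance_cells : Prop :=
  forall q, Qh q ->
  0 = sum_cells (fun K x => dot (u K x) (grad (q K) x))
      - sum_cell_boundaries (fun K F x =>
          dot (u K x) (normal K F) * q K x).

Definition mass_balance_facets : Prop :=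
  forall qbar, Qbarh qbar ->
  0 = sum_cell_boundaries (fun K F x =>
        dot (u K x) (normal K F) * qbar F x)
      - boundary_integral Omega setT (fun K F x =>
          dot (ubar F x) (normal K F) * qbar F x).

Definition momentum_balance_cells (ut : vector_field) (f : point -> point) :
    Prop :=
  forall v, Vh v ->
  sum_cells (fun K x => dot (f x) (v K x)) =
    sum_cells (fun K x => dot (ut K x) (v K x))
    - sum_cells (fun K x => ddot (sigma K x) (vgrad (v K) x))
    + sum_cell_boundaries (fun K F x =>
        ddot (sigma_hat K F x) (outer (v K x) (normal K F)))
    + sum_cell_boundaries (fun K F x =>
        nu * ddot (outer (ubar F x - u K x) (normal K F)) (vgrad (v K) x)).

Definition momentum_balance_facets (h : point -> point) : Prop :=
  forall vbar, Vbarh vbar ->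
  boundary_integral Omega GammaN (fun K F x => dot (h x) (vbar F x)) =
    sum_cell_boundaries (fun K F x =>
      ddot (sigma_hat K F x) (outer (vbar F x) (normal K F)))
    - boundary_integral Omega GammaN (fun K F x =>
        (1 - lambda K F x) * dot (ubar F x) (normal K F)
        * dot (ubar F x) (vbar F x)).

End fluxes.

Definition semidiscrete_solution (I : set R) (f h : R -> point -> point)
    (u ubar : R -> vector_field) (p pbar : R -> scalar_field) : Prop :=
  forall t, I t ->
  [/\ [/\ Vh (u t), Vbarh (ubar t), Qh (p t) & Qbarh (pbar t)],
      forall K x, K \in cells M -> hull K x ->
        time_derivable I (fun s => u s K x) t,
      mass_balance_cells (u t),
      mass_balance_facets (u t) (ubar t) &
      momentum_balance_cells (u t) (ubar t) (p t) (pbar t)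
        (fun K x => time_derivative I (fun s => u s K x) t) (f t) /\
      momentum_balance_facets (u t) (ubar t) (pbar t) (h t)].

Definition jump (a : vector_field) (Kp Km : simplex) (x : point) : R :=
  let F := Kp :&: Km in
  dot (a Kp x) (normal Kp F) + dot (a Km x) (normal Km F).

End hybrid_method.

(* Main.v *)
Require Import Defs.
From HB Require Import structures.
From mathcomp Require Import all_boot all_order all_algebra fingroup perm.
From mathcomp Require Import all_classical all_reals all_analysis.
From mathcomp Require Import measurable_realfun ring lra.
From mathcomp.multinomials Require Import (coercions, canonicals) mpoly.
Import Defs.

Set Implicit Arguments.
Unset Strict Implicit.
Unset Printing Implicit Defensive.
Import Order.TTheory GRing.Theory Num.Theory.
Import numFieldNormedType.Exports.
Local Open Scope classical_set_scope.
Local Open Scope ring_scope.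

(** Write div u for the divergence of u in a cell K, a polynomial of degree at
    most k - 1.  The mass balance on cells, tested with q = div u in K and q = 0
    in the other cells, says that the integral of u . grad q over K is the flux
    of q u through the boundary of K.  By the divergence theorem
    [divergence_theorem] the difference of the two sides is the integral of
    (div u)^2 over K, so that div u vanishes on K [divergence_free].

    The mass balance on facets is tested with a function supported on a single
    facet F [mass_balance_facet].  Two facts about the triangulation show which
    terms survive: a facet belongs to at most two cells [facet_two_cells], and a
    facet shared by two cells does not lie on the boundary of Omega
    [facet_shared_interior].  The first holds because the apexes of two cells
    sharing F are on opposite sides of F [opposite_sides], the second because a
    neighbourhood of the centre of F is covered by the two cells, while Omega is
    the interior of its closure [polytopal_regular_open].  With the jump of u.n
    (F interior) or u.n - ubar.n (F on the boundary) as test function, what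
    remains is the integral over F of the square of that function, which
    therefore vanishes on F [facet_integral_sqr_eq0].

    The divergence theorem is proved for polynomial fields on a simplex with
    vertices V_0, ..., V_(n+1) in dimension n+1.  Lebesgue measure is transported
    by affine maps [lebesgue_tuple_affine], so integrals over the cell become
    integrals over the reference simplex, and these do not depend on the order
    of the vertices [simplex_integral_perm].  Tonelli and the fundamental theorem
    of calculus along the edge from V_0 to V_j give the difference of the
    integrals over the facets opposite to V_0 and to V_j
    [simplex_integral_FTC_gen].  Decomposing the field on the edges issued from
    V_0, with the gradients m_j of the barycentric coordinates as coefficients,
    gives [simplex_integral_divergence].  Finally m_j is an inner normal to the
    facet opposite to V_j [normalE], and the Gram determinant of the edges of
    this facet is the square of |m_j| times the determinant of the edges of the
    simplex [gram_facet], which turns the sum into the surface integral. *)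

(** * Affine maps of the line *)

Section affine_line.
Context (R : realType).
Local Notation RR := (measurableTypeR R).
Local Notation mu := (@lebesgue_measure R).

Lemma measurable_affine (a b : R) :
  measurable_fun [set: RR] (fun x : RR => (a * x + b : RR)).
Proof. by apply: measurable_funD => //; apply: measurable_funM. Qed.

Lemma lebesgue_measure_affine (a b : R) (A : set RR) : a != 0 -> measurable A ->
  (`|a|%:E * pushforward mu (fun x : RR => (a * x + b)%R : RR) A = mu A)%E.
Proof.
move=> a0 mA.
have a0' : 0 <= `|a| by [].
pose m := mscale (NngNum a0')
  (measure_function_pushforward__canonical__measure_function_Measure
     [the {measure set RR -> \bar R} of mu] (measurable_affine a b)).
suff H : forall X, ocitv X -> mu X = m X.
  by rewrite (lebesgue_measure_unique H mA).
move=> _ [[u v]] _ <-; rewrite /m /mscale /= /pushforward.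
have [ap|an|aE] := ltgtP a 0; last by rewrite aE eqxx in a0.
- have -> : (fun x : R => a * x + b) @^-1` [set` `]u, v]] =
     [set` `[(v - b) / a, (u - b) / a[ ].
    apply/seteqP; split=> x /=; rewrite !in_itv /= ler_ndivrMr // ltr_ndivlMr // => /andP[h1 h2];
      apply/andP; split; lra.
  rewrite !lebesgue_measure_itv /= !lte_fin -!EFinD ltr_ndivlMr// divfK //.
  rewrite ltrBlDr subrK ltr0_norm //.
  case: ifP => _; last by rewrite mule0.
  by rewrite -EFinM; congr EFin; field.
- have -> : (fun x : R => a * x + b) @^-1` [set` `]u, v]] =
     [set` `](u - b) / a, (v - b) / a] ].
    apply/seteqP; split=> x /=; rewrite !in_itv /= ler_pdivlMr // ltr_pdivrMr // => /andP[h1 h2];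
      apply/andP; split; lra.
  rewrite !lebesgue_measure_itv /= !lte_fin -!EFinD ltr_pdivrMr// divfK //.
  rewrite ltrBlDr subrK gtr0_norm //.
  case: ifP => _; last by rewrite mule0.
  by rewrite -EFinM; congr EFin; field.
Qed.

Lemma ge0_integral_affine (a b : R) (G : RR -> \bar R) : a != 0 ->
  measurable_fun [set: RR] G -> (forall x, 0 <= G x)%E ->
  (`|a|%:E * \int[mu]_x G (a * x + b)%R = \int[mu]_x G x)%E.
Proof.
move=> a0 mG G0.
have a0' : 0 <= `|a| by [].
rewrite -[X in (_ * X)%E](@ge0_integral_pushforward _ _ RR RR R _
  (measurable_affine a b) mu [set: RR] G)//.
have -> : `|a| = (NngNum a0')%:num by [].
rewrite -(@ge0_integral_mscale _ RR R
 (measure_function_pushforward__canonical__measure_function_Measure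
     [the {measure set RR -> \bar R} of mu] (measurable_affine a b))) //.
by apply: eq_measure_integral => A mA _; exact: (lebesgue_measure_affine b a0 mA).
Qed.

End affine_line.

(** * Iterated integrals on tuples *)

Section cons_integral.
Context (R : realType).
Local Notation RR := (measurableTypeR R).
Local Notation L := (lebesgue_tuple R).
Local Notation mu := (@lebesgue_measure R).

(** The cube [a, b]^n. *)
Definition box n (a b : R) : set (n.-tuple RR) :=
  [set t | forall i, a <= tnth t i <= b].

Lemma measurable_tuple_cond n (P : 'I_n -> set RR) :
  (forall i, measurable (P i)) ->
  measurable [set t : n.-tuple RR | forall i, P i (tnth t i)].
Proof.
move=> mP.
rewrite (_ : mkset _ = \bigcap_(i in [set: 'I_n]) ((fun t : n.-tuple RR => tnth t i) @^-1` P i)).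
  apply: fin_bigcap_measurable => // i _; rewrite -[X in measurable X]setTI.
  exact: measurable_tnth.
by apply/seteqP; split => t /=; [move=> h i _|move=> h i]; apply: h.
Qed.

Lemma measurable_box n a b : measurable (@box n a b).
Proof.
apply: (@measurable_tuple_cond n (fun _ => [set` `[a, b]])) => i.
exact: measurable_itv.
Qed.

Lemma lebesgue_tupleS n (A : set (n.+1.-tuple RR)) :
  L n.+1 A = (L n \x mu)%E (@cons_tuple R n @^-1` A).
Proof. by []. Qed.

Lemma cons_tuple_forall n (P : 'I_n.+1 -> RR -> Prop) (x : n.-tuple RR) (y : RR) :
  (forall i, P i (tnth (cons_tuple (x, y)) i)) <->
  P ord0 y /\ forall i, P (lift ord0 i) (tnth x i).
Proof.
split=> [h|[h0 h] i].
  by split=> [|i]; [move: (h ord0)|move: (h (lift ord0 i))]; rewrite ?tnthS ?tnth0.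
case: (unliftP ord0 i) => [j ->|->]; by rewrite ?tnthS ?tnth0.
Qed.

Lemma lebesgue_box n a b : a <= b -> L n (@box n a b) = ((b - a) ^+ n)%:E.
Proof.
move=> ab; elim: n => [|n IHn].
  rewrite /lebesgue_tuple /= diracE mem_set //.
  by move=> [].
rewrite lebesgue_tupleS.
have -> : @cons_tuple R n @^-1` box a b = @box n a b `*` [set` `[a, b]].
  apply/seteqP; split=> [[x y]|[x y]] /=; rewrite /box /=.
    by move/(@cons_tuple_forall n (fun _ z => is_true (a <= z <= b))) => [h1 h2].
  move=> [h1 h2]; apply/(@cons_tuple_forall n (fun _ z => is_true (a <= z <= b))).
  by [].
rewrite product_measure1E //; last exact: measurable_box.
rewrite [X in (_ * X)%E](_ : _ = (b - a)%:E); first by rewrite IHn -EFinM exprSr.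
rewrite /= lebesgue_measure_itv /= lte_fin; move: ab.
rewrite le_eqVlt => /predU1P[->|->]; last first.
  by rewrite -EFinD.
by rewrite ltxx subrr.
Qed.

Lemma lebesgue_tuple_sigma_finite n : sigma_finite setT (L n).
Proof.
exists (fun k : nat => @box n (- k%:R) k%:R); last first.
  move=> k; split; first exact: measurable_box.
  have k0 : 0 <= k%:R :> R by []. 
  rewrite lebesgue_box ?ltry //; lra.
apply/seteqP; split => // t _.
exists (Num.trunc (\sum_i `|tnth t i|)).+1 => // i.
have h : \sum_i `|tnth t i| < (Num.trunc (\sum_i `|tnth t i|)).+1%:R.
  exact: truncnS_gt.
rewrite -ler_norml; apply: le_trans (ltW h).
rewrite (bigD1 i) //= lerDl; exact: sumr_ge0.
Qed.

(** The measure [lebesgue_tuple], under a name that carries a sigma-finite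
    structure, as required by the theorems of Tonelli and Fubini. *)
Definition lebesgue_sf n : set (n.-tuple RR) -> \bar R := L n.

HB.instance Definition _ n := isMeasure.Build _ _ _ (@lebesgue_sf n)
  (measure0 (L n)) (measure_ge0 (L n)) (@measure_semi_sigma_additive _ _ _ (L n)).

HB.instance Definition _ n := @Measure_isSigmaFinite.Build _ _ _ (@lebesgue_sf n)
  (@lebesgue_tuple_sigma_finite n).

Lemma ge0_integral_cons1 n (F : n.+1.-tuple RR -> \bar R) :
  measurable_fun setT F -> (forall x, 0 <= F x)%E ->
  (\int[L n.+1]_t F t = \int[L n]_x \int[mu]_y F (cons_tuple (x, y)))%E.
Proof.
move=> mF F0.
rewrite (@ge0_integral_pushforward _ _ _ _ R (@cons_tuple R n)
   (@measurable_cons_tuple R n) (L n \x mu)%E setT F)//.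
rewrite preimage_setT /=.
rewrite (@fubini_tonelli1 _ _ _ _ R (@lebesgue_sf n) mu (F \o @cons_tuple R n))//.
exact: measurableT_comp (@measurable_cons_tuple R n).
by move=> x; exact: F0.
Qed.

Lemma ge0_integral_cons2 n (F : n.+1.-tuple RR -> \bar R) :
  measurable_fun setT F -> (forall x, 0 <= F x)%E ->
  (\int[L n.+1]_t F t = \int[mu]_y \int[L n]_x F (cons_tuple (x, y)))%E.
Proof.
move=> mF F0; rewrite ge0_integral_cons1 //.
rewrite (@fubini_tonelli _ _ _ _ R (@lebesgue_sf n) mu (F \o @cons_tuple R n))//.
  exact: measurableT_comp (@measurable_cons_tuple R n).
by move=> x; exact: F0.
Qed.

Lemma measurable_integral_cons2 n (F : n.+1.-tuple RR -> \bar R) :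
  measurable_fun setT F -> (forall x, 0 <= F x)%E ->
  measurable_fun [set: RR] (fun y : RR => \int[L n]_x F (cons_tuple (x, y)))%E.
Proof.
move=> mF F0.
apply: (@measurable_fun_fubini_tonelli_G _ _ _ _ R (@lebesgue_sf n) (F \o @cons_tuple R n)) => //.
  exact: measurableT_comp (@measurable_cons_tuple R n).
by move=> x; exact: F0.
Qed.

Lemma integral_cons1 n (F : n.+1.-tuple RR -> \bar R) :
  (L n.+1).-integrable setT F ->
  (\int[L n.+1]_t F t = \int[L n]_x \int[mu]_y F (cons_tuple (x, y)))%E.
Proof.
move=> iF.
have mF : measurable_fun setT F by case/integrableP: iF.
have iF' : (L n \x mu)%E.-integrable setT (F \o @cons_tuple R n).
  apply/integrableP; split.
    exact: measurableT_comp (@measurable_cons_tuple R n).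
  case/integrableP: iF => _.
  rewrite (@ge0_integral_pushforward _ _ _ _ R (@cons_tuple R n)
   (@measurable_cons_tuple R n) (L n \x mu)%E setT (abse \o F))//.
    exact: measurableT_comp.
  by move=> y _; exact: abse_ge0.
rewrite (@integral_pushforward _ _ _ _ R (@cons_tuple R n)
   (@measurable_cons_tuple R n) (L n \x mu)%E setT F)//.
rewrite preimage_setT.
by rewrite -(@integral12_prod_meas1 _ _ _ _ R (@lebesgue_sf n) mu (F \o @cons_tuple R n)).
Qed.

End cons_integral.

(** * Affine change of variables *)

Section affine_tuple.
Context (R : realType).
Local Notation RR := (measurableTypeR R).
Local Notation L := (lebesgue_tuple R).
Local Notation mu := (@lebesgue_measure R).

Definition tuple_of_row n (v : 'rV[R]_n) : n.-tuple RR := [tuple v 0 i | i < n].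

Lemma tuple_of_rowK n : cancel (@tuple_of_row n) (@vec_of R n).
Proof. by move=> v; apply/rowP => i; rewrite mxE tnth_mktuple. Qed.

Lemma vec_ofK n : cancel (@vec_of R n) (@tuple_of_row n).
Proof. by move=> t; apply: eq_from_tnth => i; rewrite tnth_mktuple mxE. Qed.

Lemma measurable_tnthT n (i : 'I_n) :
  measurable_fun [set: n.-tuple RR] (fun t => tnth t i : RR).
Proof. exact: measurable_tnth. Qed.

Lemma measurable_affine_tuple n m (A : 'M[R]_(n, m)) b :
  measurable_fun [set: n.-tuple RR]
    (fun t : n.-tuple RR => tuple_of_row (vec_of t *m A + b)).
Proof.
apply/measurable_fun_tnthP => i.
rewrite (_ : _ \o _ = fun t => \sum_k tnth t k * A k i + b 0 i).
  apply: measurable_funD => //; apply: measurable_sum => k.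
  by apply: measurable_funM => //; exact: measurable_tnthT.
apply/funext => t /=; rewrite tnth_mktuple !mxE; congr (_ + _).
by apply: eq_bigr => k _; rewrite mxE.
Qed.

Lemma measurable_comp_affine n m (A : 'M[R]_(n, m)) b (G : 'rV[R]_m -> \bar R) :
  measurable_fun setT (G \o @vec_of R m) ->
  measurable_fun setT (fun t : n.-tuple RR => G (vec_of t *m A + b)).
Proof.
move=> mG.
rewrite (_ : (fun _ => _) = (G \o @vec_of R m) \o
   (fun t : n.-tuple RR => tuple_of_row (vec_of t *m A + b))).
  exact: measurableT_comp mG (measurable_affine_tuple A b).
by apply/funext => t /=; rewrite tuple_of_rowK.
Qed.

Lemma vec_of_cons n (x : n.-tuple RR) (y : RR) :
  vec_of (cons_tuple (x, y)) = row_mx (y%:M : 'rV_1) (vec_of x) :> 'rV_(1 + n).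
Proof.
apply/rowP => i; case: (unliftP ord0 i) => [j ->|->].
  rewrite mxE tnthS.
  have -> : lift ord0 j = rshift 1 j by apply/val_inj.
  by rewrite row_mxEr mxE.
have -> : ord0 = lshift n (ord0 : 'I_1) by apply/val_inj.
by rewrite row_mxEl !mxE /= mulr1n (tnth_nth 0).
Qed.

(** The change of variables formula for the map x |-> x A + b and non-negative
    measurable integrands. *)
Definition affine_invariant n (A : 'M[R]_n) (b : 'rV[R]_n) :=
  forall G : 'rV[R]_n -> \bar R,
  measurable_fun setT (G \o @vec_of R n) -> (forall x, 0 <= G x)%E ->
  (`|\det A|%:E * \int[L n]_t G (vec_of t *m A + b)%R = \int[L n]_t G (vec_of t))%E.

Lemma affine_invariantM n (A B : 'M[R]_n) b c :
  affine_invariant A b -> affine_invariant B c ->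
  affine_invariant (A *m B) (b *m B + c).
Proof.
move=> hA hB G mG G0.
rewrite det_mulmx normrM mulrC EFinM -muleA -hB //; congr (_ * _)%E.
rewrite -(hA (fun x => G (x *m B + c))) //; last exact: measurable_comp_affine.
by under eq_integral do rewrite mulmxA addrA -mulmxDl.
Qed.

Lemma ge0_integral_row1 n (G : 'rV[R]_(1 + n) -> \bar R) :
  measurable_fun setT (G \o @vec_of R (1 + n)) -> (forall x, 0 <= G x)%E ->
  (\int[L (1 + n)]_t G (vec_of t) =
   \int[L n]_x \int[mu]_y G (row_mx (y%:M : 'rV_1) (vec_of x)))%E.
Proof.
move=> mG G0; rewrite (ge0_integral_cons1 mG) => [|t]; last exact: G0.
by under eq_integral => x _ do under eq_integral => y _ do rewrite /= vec_of_cons.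
Qed.

Lemma ge0_integral_row2 n (G : 'rV[R]_(1 + n) -> \bar R) :
  measurable_fun setT (G \o @vec_of R (1 + n)) -> (forall x, 0 <= G x)%E ->
  (\int[L (1 + n)]_t G (vec_of t) =
   \int[mu]_y \int[L n]_x G (row_mx (y%:M : 'rV_1) (vec_of x)))%E.
Proof.
move=> mG G0; rewrite (ge0_integral_cons2 mG) => [|t]; last exact: G0.
by under eq_integral => x _ do under eq_integral => y _ do rewrite /= vec_of_cons.
Qed.

Lemma measurable_section_row n (G : 'rV[R]_(1 + n) -> \bar R) (y : R) :
  measurable_fun setT (G \o @vec_of R (1 + n)) ->
  measurable_fun [set: n.-tuple RR]
   (fun x : n.-tuple RR => G (row_mx (y%:M : 'rV_1) (vec_of x))).
Proof.
move=> mG.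
rewrite (_ : (fun _ => _) = (G \o @vec_of R (1 + n)) \o
  (@cons_tuple R n) \o (fun x => (x, y : RR))).
  apply: measurableT_comp; last exact: measurable_pair2.
  exact: measurableT_comp mG (@measurable_cons_tuple R n).
by apply/funext => t /=; rewrite vec_of_cons.
Qed.

Lemma measurable_section_row1 n (G : 'rV[R]_(1 + n) -> \bar R) (x : n.-tuple RR) :
  measurable_fun setT (G \o @vec_of R (1 + n)) ->
  measurable_fun [set: RR]
   (fun y : RR => G (row_mx (y%:M : 'rV_1) (vec_of x))).
Proof.
move=> mG.
rewrite (_ : (fun _ => _) = (G \o @vec_of R (1 + n)) \o
  (@cons_tuple R n) \o (fun y => (x, y : RR))).
  apply: measurableT_comp; last exact: measurable_pair1.
  exact: measurableT_comp mG (@measurable_cons_tuple R n).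
by apply/funext => t /=; rewrite vec_of_cons.
Qed.

Lemma measurable_integral_row n (G : 'rV[R]_(1 + n) -> \bar R) :
  measurable_fun setT (G \o @vec_of R (1 + n)) -> (forall x, 0 <= G x)%E ->
  measurable_fun [set: RR]
   (fun y : RR => \int[L n]_x G (row_mx (y%:M : 'rV_1) (vec_of x)))%E.
Proof.
move=> mG G0.
have := @measurable_integral_cons2 R n (G \o @vec_of R (1 + n)) mG (fun t => G0 _).
congr measurable_fun; apply/funext => y.
by apply: eq_integral => x _ /=; rewrite vec_of_cons.
Qed.

(** Integrate over the last n variables first: for a fixed first coordinate the
    block B acts on them, up to a translation. *)
Lemma affine_invariant_upper n (a : R) r (B : 'M[R]_n) b : a != 0 ->
  (forall c, affine_invariant B c) ->
  affine_invariant (block_mx a%:M r 0 B : 'M[R]_(1 + n)) b.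
Proof.
move=> a0 hB G mG G0.
rewrite det_ublock det_scalar1.
pose H y := (\int[L n]_x G (row_mx (y%:M : 'rV_1) (vec_of x)))%E.
pose b0 := lsubmx b 0 0; pose b1 := rsubmx b.
have E (y : R) (x : 'rV[R]_n) : row_mx (y%:M : 'rV_1) x *m block_mx a%:M r 0 B + b =
    row_mx ((a * y + b0)%:M : 'rV_1) (x *m B + (y *: r + b1)).
  rewrite -[b]hsubmxK mul_row_block mulmx0 addr0 add_row_mx -/b1; congr row_mx.
    by rewrite (mx11_scalar (lsubmx b)) -/b0 -scalar_mxM -raddfD /= mulrC.
  by rewrite mul_scalar_mx [RHS]addrCA addrA.
rewrite (@ge0_integral_row2 n (fun x => G (x *m block_mx a%:M r 0 B + b))
  (measurable_comp_affine _ _ mG)) //.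
rewrite ge0_integral_row2 // -/H.
rewrite normrM EFinM -muleA.
have -> : (`|\det B|%:E *
   \int[mu]_y \int[L n]_x G (row_mx (y%:M : 'rV_1) (vec_of x) *m block_mx a%:M r 0 B + b)%R
   = \int[mu]_y H (a * y + b0)%R)%E.
  rewrite -ge0_integralZl //; last 2 first.
  - apply: (@measurable_integral_row n (fun x => G (x *m block_mx a%:M r 0 B + b))) => //.
    exact: measurable_comp_affine.
  - by move=> y _; apply: integral_ge0.
  apply: eq_integral => y _.
  under eq_integral do rewrite E.
  rewrite (hB _ (fun x => G (row_mx ((a * y + b0)%:M : 'rV_1) x))) //.
  exact: measurable_section_row.
rewrite ge0_integral_affine //; first exact: measurable_integral_row.
by move=> y; exact: integral_ge0.
Qed.

(** Integrate over the first variable first: for fixed other coordinates the map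
    is a translation of the line. *)
Lemma affine_invariant_lower n (c : 'cV[R]_n) :
  affine_invariant (block_mx 1%:M 0 c 1%:M : 'M[R]_(1 + n)) 0.
Proof.
move=> G mG G0.
rewrite det_lblock !det1 mulr1 normr1 mul1e.
rewrite (@ge0_integral_row1 n (fun x => G (x *m block_mx 1%:M 0 c 1%:M + 0))
  (measurable_comp_affine _ _ mG)) //.
rewrite (ge0_integral_row1 mG) //.
apply: eq_integral => x _.
pose b := (vec_of x *m c) 0 0.
rewrite -(@ge0_integral_affine R 1 b (fun y => G (row_mx (y%:M : 'rV_1) (vec_of x)))) //.
- rewrite normr1 mul1e; apply: eq_integral => y _; congr G.
  rewrite mul_row_block !mulmx1 mulmx0 add0r addr0; congr row_mx.
  by rewrite (mx11_scalar (vec_of x *m c)) -raddfD /= mul1r.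
- exact: measurable_section_row1.
Qed.

(** Every invertible matrix is a product of block triangular matrices covered by
    the two previous lemmas; the formula is inherited by products. *)
Lemma lebesgue_tuple_affine n (A : 'M[R]_n) b :
  A \in unitmx -> affine_invariant A b.
Proof.
elim: n A b => [A b _ G mG G0|n IHn A b Au].
  rewrite det_mx00 normr1 mul1e; apply: eq_integral => t _; congr G.
  by apply/rowP => -[].
pose M := (A : 'M[R]_(1 + n)).
(* a row operation makes the top left pivot nonzero *)
have [s hs] : exists s : 'rV[R]_n, ulsubmx M 0 0 + (s *m dlsubmx M) 0 0 != 0.
  have [a0|a0] := eqVneq (ulsubmx M 0 0) 0; last first.
    by exists 0; rewrite mul0mx [X in _ + X]mxE addr0.
  have [c0|/cV0Pn [i ci]] := eqVneq (dlsubmx M) 0.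
    move: Au; rewrite unitmxE (_ : \det A = 0) ?unitr0 //.
    change (\det M = 0); rewrite -[M]submxK c0 det_ublock (mx11_scalar (ulsubmx M)) a0.
    by rewrite det_scalar1 mul0r.
  by exists (delta_mx 0 i); rewrite a0 add0r -rowE mxE.
pose S x : 'M[R]_(1 + n) := block_mx 1%:M x 0 1%:M.
pose A1 := S s *m M.
have EA1 : A1 = block_mx (ulsubmx M + s *m dlsubmx M) (ursubmx M + s *m drsubmx M)
    (dlsubmx M) (drsubmx M).
  by rewrite /A1 /S -{1}[M]submxK mulmx_block !mul1mx !mul0mx !add0r.
have EA : M = S (- s) *m A1.
  rewrite /A1 mulmxA /S mulmx_block !mulmx1 !mulmx0 !mul0mx !addr0 !add0r mul1mx.
  by rewrite subrr -scalar_mx_block mul1mx.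
pose a1 := ulsubmx M 0 0 + (s *m dlsubmx M) 0 0.
have Ea1 : ulsubmx M + s *m dlsubmx M = a1%:M.
  by rewrite [LHS]mx11_scalar mxE.
pose c := dlsubmx M *m (a1^-1)%:M.
pose r := ursubmx M + s *m drsubmx M.
pose B := drsubmx M - c *m r.
have EA2 : A1 = block_mx 1%:M 0 c 1%:M *m (block_mx a1%:M r 0 B : 'M[R]_(1 + n)).
  rewrite EA1 Ea1 mulmx_block !mul1mx !mul0mx !addr0 {1}/c -mulmxA.
  by rewrite -scalar_mxM mulVf // mulmx1 /B [c *m r + _]addrC subrK.
have Bu : B \in unitmx.
  move: Au; rewrite !unitmxE !unitfE; apply: contraNneq => B0.
  change (\det M == 0); rewrite EA EA2 !det_mulmx [\det (block_mx a1%:M _ _ _)]det_ublock B0.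
  by rewrite !mulr0.
have U c' : affine_invariant (S (- s)) c'.
  apply: (@affine_invariant_upper n 1); first exact: oner_neq0.
  by move=> c''; apply: IHn; exact: unitmx1.
have h2 : affine_invariant A1 0.
  rewrite EA2 -[X in affine_invariant _ X]addr0.
  rewrite -[X in affine_invariant _ (X + _)](mul0mx _ (block_mx a1%:M r 0 B)).
  apply: affine_invariantM; first exact: affine_invariant_lower.
  by apply: affine_invariant_upper => // c'; exact: IHn.
have A1u : A1 \in unitmx.
  move: (Au : M \in unitmx); rewrite EA unitmx_mul => /andP[] //.
have -> : b = (b *m invmx A1) *m A1 + 0 by rewrite mulmxKV // addr0.
rewrite (EA : A = _).
exact: affine_invariantM.
Qed.

End affine_tuple.

(** * Polynomial functions *)

Section polynomial_functions.
Context (R : realType).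
Local Notation RR := (measurableTypeR R).
Local Notation meval := (@mpoly.meval _ R).

(** Polynomial functions without a bound on the degree. *)
Definition polyfun n (g : 'rV[R]_n -> R) :=
  exists p : mpoly.mpoly n R, forall x, g x = meval (fun i => x 0 i) p.

Lemma polyfunP n (g : 'rV[R]_n -> R) :
  polyfun g <-> exists p : mpoly.mpoly n R, g = fun x => meval (fun i => x 0 i) p.
Proof.
by split=> -[p gp]; exists p; [apply/funext => x|move=> x]; rewrite gp.
Qed.

Lemma polyfun_cst n (c : R) : polyfun (fun _ : 'rV[R]_n => c).
Proof. by exists (mpoly.mpolyC n c) => x; rewrite mpoly.mevalC. Qed.

Lemma polyfun_coord n (i : 'I_n) : polyfun (fun x : 'rV[R]_n => x 0 i).
Proof. by exists (mpoly.mpolyX R (mpoly.mnm1 i)) => x; rewrite mpoly.mevalXU. Qed.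

Lemma polyfunD n (f g : 'rV[R]_n -> R) :
  polyfun f -> polyfun g -> polyfun (fun x => f x + g x).
Proof. by move=> [p fp] [q gq]; exists (p + q) => x; rewrite fp gq mpoly.mevalD. Qed.

Lemma polyfunM n (f g : 'rV[R]_n -> R) :
  polyfun f -> polyfun g -> polyfun (fun x => f x * g x).
Proof. by move=> [p fp] [q gq]; exists (p * q) => x; rewrite fp gq mpoly.mevalM. Qed.

Lemma polyfunN n (f : 'rV[R]_n -> R) :
  polyfun f -> polyfun (fun x => - f x).
Proof. by move=> [p fp]; exists (- p) => x; rewrite fp mpoly.mevalN. Qed.

Lemma polyfun_sum n I (r : seq I) (P : pred I) (f : I -> 'rV[R]_n -> R) :
  (forall i, polyfun (f i)) -> polyfun (fun x => \sum_(i <- r | P i) f i x).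
Proof.
move=> hf; elim: r => [|i r IHr].
  by under eq_fun do rewrite big_nil; exact: polyfun_cst.
under eq_fun do rewrite big_cons; case: (P i) => //.
exact: polyfunD.
Qed.

(** Polynomial functions are generated by constants and coordinates. *)
Lemma polyfun_ind n (P : ('rV[R]_n -> R) -> Prop) :
  (forall c, P (fun _ => c)) -> (forall i, P (fun x => x 0 i)) ->
  (forall f g, polyfun f -> polyfun g -> P f -> P g -> P (fun x => f x + g x)) ->
  (forall f g, polyfun f -> polyfun g -> P f -> P g -> P (fun x => f x * g x)) ->
  forall g, polyfun g -> P g.
Proof.
move=> Pc Px PD PM g /polyfunP[p ->{g}].
have hp q : polyfun (fun x : 'rV[R]_n => meval (fun i => x 0 i) q) by exists q.
elim/mpoly.mpolyind: p => [|c m p _ _ IHp].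
  by under eq_fun do rewrite mpoly.meval0.
under eq_fun do rewrite mpoly.mevalD.
apply: (PD) => //.
under eq_fun do rewrite mpoly.mevalZ.
suff H : P (fun x : 'rV[R]_n => meval (fun i => x 0 i) (mpoly.mpolyX R m)).
  by apply: (PM) => //; exact: polyfun_cst.
rewrite mpoly.mpolyXE_id.
elim: (index_enum _) => [|i r IHr].
  by under eq_fun do rewrite big_nil mpoly.meval1.
under eq_fun do rewrite big_cons mpoly.mevalM.
apply: (PM) => //.
elim: (mpoly.fun_of_multinom m _) => [|k IHk].
  by under eq_fun do rewrite expr0 mpoly.meval1.
under eq_fun do rewrite exprS mpoly.mevalM mpoly.mevalXU.
by apply: (PM) => //; exact: polyfun_coord.
Qed.

Lemma polyfun_affine n m (A : 'M[R]_(n, m)) b (g : 'rV[R]_m -> R) :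
  polyfun g -> polyfun (fun x : 'rV[R]_n => g (x *m A + b)).
Proof.
elim/polyfun_ind => [c|i|f h _ _|f h _ _]; [exact: polyfun_cst| |exact: polyfunD|exact: polyfunM].
under eq_fun do rewrite !mxE.
apply: polyfunD; last exact: polyfun_cst.
apply: polyfun_sum => k; apply: polyfunM; first exact: polyfun_coord.
exact: polyfun_cst.
Qed.

Lemma polyfun_measurable n (g : 'rV[R]_n -> R) :
  polyfun g -> measurable_fun [set: n.-tuple RR] (g \o @vec_of R n : _ -> RR).
Proof.
elim/polyfun_ind => [c|i|f h _ _ mf mh|f h _ _ mf mh].
- exact: measurable_cst.
- rewrite (_ : _ \o _ = fun t => tnth t i); first exact: measurable_tnthT.
  by apply/funext => t /=; rewrite mxE.
- exact: (measurable_funD mf mh).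
- exact: (measurable_funM mf mh).
Qed.

Lemma polyfun_continuous n (g : 'rV[R]_n -> R) : polyfun g -> continuous g.
Proof.
elim/polyfun_ind => [c|i|f h _ _ cf ch|f h _ _ cf ch] x.
- exact: cst_continuous.
- exact: coord_continuous.
- exact: (continuousD (cf x) (ch x)).
- exact: (continuousM (cf x) (ch x)).
Qed.

Lemma polyfun_bounded n (g : 'rV[R]_n -> R) (a b : R) : polyfun g ->
  exists C, forall x : 'rV[R]_n, (forall i, a <= x 0 i <= b) -> `|g x| <= C.
Proof.
elim/polyfun_ind => [c|i|f h _ _ [C hC] [D hD]|f h _ _ [C hC] [D hD]].
- by exists `|c|.
- exists (`|a| + `|b|) => x /(_ i) /andP[h1 h2].
  have [ha hb] := (ler_norm (- a), ler_norm b); rewrite normrN in ha.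
  have [a0 b0] := (normr_ge0 a, normr_ge0 b).
  by rewrite ler_norml; apply/andP; split; lra.
- exists (C + D) => x hx; apply: le_trans (ler_normD _ _) _.
  by rewrite lerD ?hC ?hD.
- exists (C * D) => x hx; rewrite normrM ler_pM ?hC ?hD //.
Qed.

Lemma is_derive_coord n (x v : 'rV[R]_n) (i : 'I_n) :
  is_derive x v (fun y : 'rV[R]_n => y 0 i) (v 0 i).
Proof.
have H : (fun h : R => h^-1 *: ((h *: v + x) 0 i - x 0 i)) @ 0^' --> v 0 i.
  apply: cvg_near_cst; near=> h.
  rewrite !mxE addrK /GRing.scale /= mulrA mulVf ?mul1r //.
  by near: h; exact: nbhs_dnbhs_neq.
split; first by apply/cvg_ex; exists (v 0 i).
exact: cvg_lim.
Unshelve. all: end_near. Qed.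

Lemma polyfun_derive n (g : 'rV[R]_n -> R) (v : 'rV[R]_n) : polyfun g ->
  (forall x, derivable g x v) /\ polyfun ('D_v g).
Proof.
elim/polyfun_ind => [c|i|f h pf ph [df Df] [dh Dh]|f h pf ph [df Df] [dh Dh]].
- split=> [x|]; first exact: derivable_cst.
  under eq_fun do rewrite derive_cst; exact: polyfun_cst.
- have H x := @is_derive_coord n x v i.
  split=> [x|]; first exact: ex_derive.
  under eq_fun do rewrite derive_val; exact: polyfun_cst.
- split=> [x|]; first exact: derivableD.
  by under eq_fun do rewrite deriveD //; exact: polyfunD.
- split=> [x|]; first exact: derivableM.
  under eq_fun do rewrite deriveM //.
  by apply: polyfunD; apply: polyfunM.
Qed.

Lemma derive_meval n (p : mpoly.mpoly n R) (i : 'I_n) (x : 'rV[R]_n) :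
  'D_(delta_mx 0 i) (fun y : 'rV[R]_n => meval (fun j => y 0 j) p) x =
  meval (fun j => x 0 j) (mpoly.mderiv i p).
Proof.
pose Q q := 'D_(delta_mx 0 i) (fun y : 'rV[R]_n => meval (fun j => y 0 j) q) x =
  meval (fun j => x 0 j) (mpoly.mderiv i q).
have dq q : derivable (fun y : 'rV[R]_n => meval (fun j => y 0 j) q) x (delta_mx 0 i).
  by apply: (@polyfun_derive n _ _ _).1; exists q.
have QC c : Q (mpoly.mpolyC n c).
  rewrite /Q mpoly.mderivC mpoly.meval0; under eq_fun do rewrite mpoly.mevalC.
  exact: derive_cst.
have QX j : Q (mpoly.mpolyX R (mpoly.mnm1 j)).
  rewrite /Q; under eq_fun do rewrite mpoly.mevalXU.
  have H := @is_derive_coord n x (delta_mx 0 i) j.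
  rewrite derive_val mpoly.mderivX mpoly.mnm1E !mxE eqxx /= mpoly.mevalZ eq_sym.
  have [->|] := eqVneq; last by rewrite mul0r.
  rewrite mul1r mpoly.mevalX big1 // => k _.
  by rewrite mpoly.mnmBE subnn expr0.
have QD q r : Q q -> Q r -> Q (q + r).
  rewrite /Q => hq hr; rewrite mpoly.mderivD mpoly.mevalD -hq -hr -deriveD //.
  by congr ('D_ _ _ _); apply/funext => y; rewrite mpoly.mevalD.
have QM q r : Q q -> Q r -> Q (q * r).
  rewrite /Q => hq hr; rewrite mpoly.mderivM mpoly.mevalD !mpoly.mevalM -hq -hr.
  transitivity ('D_(delta_mx 0 i)
   ((fun y : 'rV[R]_n => meval (fun j => y 0 j) q) *
    (fun y : 'rV[R]_n => meval (fun j => y 0 j) r)) x).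
    by congr ('D_ _ _ _); apply/funext => y; rewrite mpoly.mevalM.
  rewrite deriveM // addrC /GRing.scale /= mulrC; congr (_ + _); rewrite mulrC //.
rewrite -/(Q p); elim/mpoly.mpolyind: p => [|c m p _ _ IHp].
  by rewrite -(mpoly.mpolyC0 n R); exact: (QC).
apply: (QD) => //; rewrite -mpoly.mul_mpolyC; apply: (QM); first exact: (QC).
rewrite mpoly.mpolyXE_id.
elim: (index_enum _) => [|j r IHr]; first by rewrite big_nil -mpoly.mpolyC1; exact: (QC).
rewrite big_cons; apply: (QM) => //.
elim: (mpoly.fun_of_multinom m _) => [|k IHk]; first by rewrite expr0 -mpoly.mpolyC1; exact: (QC).
by rewrite exprS; exact: QM.
Qed.

End polynomial_functions.

(** * The reference simplex *)

Section reference_simplex.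
Context (R : realType).
Local Notation RR := (measurableTypeR R).
Local Notation L := (lebesgue_tuple R).
Local Notation ref n := (@ref_simplex R n).

Lemma measurable_ref n : measurable (ref n).
Proof.
rewrite (_ : ref n = [set t | forall i, [set` `[0, +oo[] (tnth t i)] `&`
   ((fun t : n.-tuple RR => \sum_i tnth t i) @^-1` [set` `]-oo, 1] ])).
  apply: measurableI.
    by apply: (@measurable_tuple_cond R n (fun=> [set` `[0, +oo[])) => i; exact: measurable_itv.
  have mS : measurable_fun [set: n.-tuple RR] (fun t => \sum_i tnth t i : RR).
    by apply: measurable_sum => i; exact: measurable_tnthT.
  by rewrite -[X in measurable X]setTI; apply: mS => //; exact: measurable_itv.
apply/seteqP; split => t; rewrite /ref_simplex /=; move=> [h1 h2]; split.
- by move=> i; rewrite in_itv /= andbT.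
- by rewrite in_itv.
- by move=> i; move: (h1 i); rewrite in_itv /= andbT.
- by move: h2; rewrite in_itv.
Qed.

Lemma ref_sub_box n : ref n `<=` box 0 1.
Proof.
move=> t [t0 t1] i; rewrite t0 /= (le_trans _ t1) // (bigD1 i) //= lerDl.
exact: sumr_ge0.
Qed.

Lemma ref_lty n : (L n (ref n) < +oo)%E.
Proof.
apply: (@le_lt_trans _ _ (L n (box 0 1))).
  apply: le_measure; rewrite ?inE; [exact: measurable_ref|exact: measurable_box|exact: ref_sub_box].
by rewrite lebesgue_box // ltry.
Qed.

Lemma ref_gt0 n : (0 < L n (ref n))%E.
Proof.
have c0 : 0 < n.+1%:R^-1 :> R by rewrite invr_gt0.
apply: (@lt_le_trans _ _ (L n (box 0 n.+1%:R^-1))).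
  by rewrite lebesgue_box ?(ltW c0) // subr0 lte_fin exprn_gt0.
apply: le_measure; rewrite ?inE; [exact: measurable_box|exact: measurable_ref|].
move=> t ht; split; first by move=> i; case/andP: (ht i).
apply: (@le_trans _ _ (\sum_(i < n) n.+1%:R^-1)).
  by apply: ler_sum => i _; case/andP: (ht i).
by rewrite sumr_const card_ord -[leLHS]mulr_natr mulrC ler_pdivrMr // mul1r ler_nat.
Qed.

Lemma integrable_ref n (g : 'rV[R]_n -> R) : polyfun g ->
  (L n).-integrable (ref n) (fun t => (g (vec_of t))%:E).
Proof.
move=> pg; have [C hC] := polyfun_bounded 0 1 pg.
have H := @measurable_bounded_integrable _ _ _ (L n) (g \o @vec_of R n) (ref n)
  (@measurable_ref n) (ref_lty n).
apply: H.
- by apply: measurable_funTS; exact: polyfun_measurable.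
- exists C; split=> [|M CM t rt /=]; first exact: num_real.
  apply: le_trans (ltW CM); apply: hC => i.
  by rewrite mxE; exact: ref_sub_box.
Qed.

(** The extension by zero of the restriction of g to the reference simplex. *)
Definition ref_restrict n (g : 'rV[R]_n -> R) (x : 'rV[R]_n) : R :=
  ((fun t : n.-tuple RR => g (vec_of t)) \_ (ref n)) (tuple_of_row x).

Lemma ref_restrictE n (g : 'rV[R]_n -> R) (t : n.-tuple RR) :
  ref_restrict g (vec_of t) = ((fun t => g (vec_of t)) \_ (ref n)) t.
Proof. by rewrite /ref_restrict vec_ofK. Qed.

Lemma integrable_ref_restrict n (g : 'rV[R]_n -> R) : polyfun g ->
  (L n).-integrable setT (fun t => (ref_restrict g (vec_of t))%:E).
Proof.
move=> /integrable_ref /(integrable_mkcond _ (@measurable_ref n)).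
congr (_.-integrable _); apply/funext => t; rewrite ref_restrictE !patchE.
by case: ifP.
Qed.

Lemma measurable_ref_restrict n (g : 'rV[R]_n -> R) : polyfun g ->
  measurable_fun setT ((ref_restrict g \o @vec_of R n) : _ -> RR).
Proof. by move/integrable_ref_restrict/integrableP => -[/measurable_EFinP]. Qed.

Lemma integral_ref_restrict n (g : 'rV[R]_n -> R) :
  \int[L n]_t ref_restrict g (vec_of t) = \int[L n]_(t in ref n) g (vec_of t).
Proof.
rewrite [RHS]Rintegral_mkcond; apply: eq_Rintegral => t _.
by rewrite ref_restrictE.
Qed.

End reference_simplex.

(** * Integrals over parametrized simplices *)

Section simplex_integral.
Context (R : realType) (d : nat).
Local Notation RR := (measurableTypeR R).
Local Notation L := (lebesgue_tuple R).
Local Notation ref n := (@ref_simplex R n).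

(** The edges issued from the first vertex of a family of vertices. *)
Definition edge_mx d' n (V : 'I_n.+1 -> 'rV[R]_d') : 'M[R]_(n, d') :=
  \matrix_(j < n) (V (lift ord0 j) - V ord0).

(** The affine map sending the vertices of the reference simplex to V. *)
Definition simplex_point d' n (V : 'I_n.+1 -> 'rV[R]_d') (x : 'rV[R]_n) : 'rV[R]_d' :=
  x *m edge_mx V + V ord0.

(** The integral of g over the simplex with vertices V, normalized so that its
    surface or volume element is that of the reference simplex. *)
Definition simplex_integral n (V : 'I_n.+1 -> 'rV[R]_d) (g : 'rV[R]_d -> R) : R :=
  \int[L n]_(t in ref n) g (simplex_point V (vec_of t)).

(** Barycentric coordinates with respect to the reference simplex; the index 0
    stands for the vertex at the origin. *)
Definition bary n (x : 'rV[R]_n) (i : 'I_n.+1) : R :=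
  if unlift ord0 i is Some j then x 0 j else 1 - \sum_j x 0 j.

Lemma bary0 n (x : 'rV[R]_n) : bary x ord0 = 1 - \sum_j x 0 j.
Proof. by rewrite /bary unlift_none. Qed.

Lemma baryS n (x : 'rV[R]_n) j : bary x (lift ord0 j) = x 0 j.
Proof. by rewrite /bary liftK. Qed.

Lemma bary_sum n (x : 'rV[R]_n) : \sum_i bary x i = 1.
Proof.
rewrite big_ord_recl (eq_bigr (fun j => x 0 j)) => [|j _]; last exact: baryS.
by rewrite bary0 subrK.
Qed.

Lemma refP n (x : 'rV[R]_n) : ref n (tuple_of_row x) <-> forall i, 0 <= bary x i.
Proof.
rewrite /ref_simplex /=.
have -> : \sum_i tnth (tuple_of_row x) i = \sum_i x 0 i.
  by apply: eq_bigr => i _; rewrite tnth_mktuple.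
split=> [[h1 h2] i|h].
  case: (unliftP ord0 i) => [j ->|->]; rewrite ?baryS ?bary0; last by rewrite subr_ge0.
  by move: (h1 j); rewrite tnth_mktuple.
split=> [i|]; first by rewrite tnth_mktuple -baryS.
by rewrite -subr_ge0 -bary0.
Qed.

Lemma simplex_pointE d' n (V : 'I_n.+1 -> 'rV[R]_d') x :
  simplex_point V x = \sum_i bary x i *: V i.
Proof.
rewrite big_ord_recl bary0 /simplex_point mulmx_sum_row.
rewrite scalerBl scale1r addrC -addrA; congr (_ + _).
rewrite scaler_suml addrC -sumrB; apply: eq_bigr => j _.
by rewrite rowK baryS scalerBr.
Qed.

(** The vertices of the reference simplex. *)
Definition ref_vtx n (i : 'I_n.+1) : 'rV[R]_n :=
  if unlift ord0 i is Some j then delta_mx 0 j else 0.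

Lemma edge_ref_vtx n : edge_mx (@ref_vtx n) = 1%:M.
Proof.
apply/row_matrixP => j; rewrite rowK row1 /ref_vtx liftK unlift_none subr0 //.
Qed.

Lemma simplex_ref_vtx d' n (V : 'I_n.+1 -> 'rV[R]_d') i :
  simplex_point V (ref_vtx i) = V i.
Proof.
rewrite /simplex_point /ref_vtx; case: (unliftP ord0 i) => [j ->|->].
  by rewrite -rowE rowK subrK.
by rewrite mul0mx add0r.
Qed.

Lemma simplex_pointB d' n (V : 'I_n.+1 -> 'rV[R]_d') x y :
  simplex_point V x - simplex_point V y = (x - y) *m edge_mx V.
Proof. by rewrite /simplex_point opprD addrACA subrr addr0 mulmxBl. Qed.

(** Choosing vertices amounts to composing with an affine map between reference
    simplices. *)
Lemma edge_mx_comp d' n m (V : 'I_n.+1 -> 'rV[R]_d') (s : 'I_m.+1 -> 'I_n.+1) :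
  edge_mx (V \o s) = edge_mx (@ref_vtx n \o s) *m edge_mx V.
Proof.
apply/row_matrixP => j; rewrite row_mul !rowK /= -simplex_pointB.
by rewrite !simplex_ref_vtx.
Qed.

Lemma simplex_point_comp d' n m (V : 'I_n.+1 -> 'rV[R]_d') (s : 'I_m.+1 -> 'I_n.+1) x :
  simplex_point (V \o s) x = simplex_point V (simplex_point (@ref_vtx n \o s) x).
Proof.
rewrite /simplex_point edge_mx_comp mulmxA mulmxDl -addrA; congr (_ + _).
by rewrite -[LHS](simplex_ref_vtx V (s ord0)).
Qed.

Lemma edge_perm_unit n (s : 'S_n.+1) : edge_mx (@ref_vtx n \o s) \in unitmx.
Proof.
have := edge_mx_comp (@ref_vtx n \o (s^-1)%g) s.
rewrite (_ : _ \o s = @ref_vtx n); last by apply/funext => i /=; rewrite permK.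
by rewrite edge_ref_vtx => /esym/mulmx1_unit[].
Qed.

Lemma ref_perm n (s : 'S_n.+1) (x : 'rV[R]_n) :
  ref n (tuple_of_row (simplex_point (@ref_vtx n \o s) x)) <-> ref n (tuple_of_row x).
Proof.
pose D (i : 'I_n.+1) : 'rV[R]_n.+1 := delta_mx 0 i.
have baryE y i : bary y i = simplex_point D y 0 i.
  rewrite simplex_pointE summxE (bigD1 i) //= !mxE !eqxx mulr1 big1 ?addr0 // => j ji.
  by rewrite !mxE eq_sym (negPf ji) andbF mulr0.
have H i : bary (simplex_point (@ref_vtx n \o s) x) (s i) = bary x i.
  rewrite baryE -simplex_point_comp simplex_pointE summxE (bigD1 i) //=.
  rewrite !mxE !eqxx mulr1 big1 ?addr0 // => j ji.
  by rewrite !mxE /= (inj_eq perm_inj) eq_sym (negPf ji) mulr0.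
rewrite !refP; split=> h i; first by rewrite -H.
by rewrite -[i](permKV s) H.
Qed.

End simplex_integral.

Section change_of_variables.
Context (R : realType).
Local Notation RR := (measurableTypeR R).
Local Notation L := (lebesgue_tuple R).
Local Notation ref n := (@ref_simplex R n).

(** Reordering its vertices maps the reference simplex onto itself and so
    preserves its volume, which is positive and finite. *)
Lemma det_edge_perm n (s : 'S_n.+1) :
  `|\det (edge_mx (@ref_vtx R n \o s))| = 1.
Proof.
set A := edge_mx _.
have Au : A \in unitmx by exact: edge_perm_unit.
pose G (x : 'rV[R]_n) : \bar R := (\1_(ref n) (tuple_of_row x))%:E.
have mG : measurable_fun setT (G \o @vec_of R n).
  rewrite (_ : _ \o _ = fun t => (\1_(ref n) t)%:E).
    by apply/measurable_EFinP; apply: measurable_indic; exact: measurable_ref.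
  by apply/funext => t /=; rewrite /G vec_ofK.
have G0 x : (0 <= G x)%E by rewrite lee_fin.
have := lebesgue_tuple_affine (ref_vtx R (s ord0)) Au mG G0.
have E1 : (\int[L n]_t G (vec_of t) = L n (ref n))%E.
  under eq_integral do rewrite /G vec_ofK.
  by rewrite integral_indic ?setIT //; exact: measurable_ref.
have E2 x : G (x *m A + ref_vtx R (s ord0))%R = G x.
  rewrite /G !indicE; congr (_%:R%:E); congr nat_of_bool; apply/idP/idP;
  by rewrite !inE; have := ref_perm s x; rewrite /simplex_point /= => -[h1 h2] ?; auto.
under eq_integral do rewrite E2.
rewrite E1; have := ref_gt0 R n; have := ref_lty R n.
case: (L n (ref n)) => // v _; rewrite lte_fin => v0 /eqP; rewrite -EFinM eqe => /eqP h.
by apply: (@mulIf _ v); rewrite ?gt_eqF // mul1r.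
Qed.

Lemma integral_affine n (A : 'M[R]_n) b (g : 'rV[R]_n -> R) : A \in unitmx ->
  measurable_fun setT ((g \o @vec_of R n) : _ -> RR) ->
  (L n).-integrable setT (fun t => (g (vec_of t))%:E) ->
  `|\det A| * (\int[L n]_t g (vec_of t *m A + b)) = \int[L n]_t g (vec_of t).
Proof.
move=> Au mg ig.
have dA : `|\det A| != 0 by rewrite normr_eq0; move: Au; rewrite unitmxE unitfE.
pose gE (x : 'rV[R]_n) : \bar R := (g x)%:E.
have mE : measurable_fun setT (gE \o @vec_of R n) by exact/measurable_EFinP.
have mgp : measurable_fun setT (gE^\+%E \o @vec_of R n).
  by rewrite -funepos_comp; apply: measurable_funepos.
have mgn : measurable_fun setT (gE^\-%E \o @vec_of R n).
  by rewrite -funeneg_comp; apply: measurable_funeneg.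
have hp := lebesgue_tuple_affine b Au mgp (fun x => funepos_ge0 _ x).
have hn := lebesgue_tuple_affine b Au mgn (fun x => funeneg_ge0 _ x).
have fp : (\int[L n]_t gE^\+%E (vec_of t))%E \is a fin_num.
  have := integrable_pos_fin_num measurableT ig.
  by rewrite (funepos_comp gE (@vec_of R n)).
have fn : (\int[L n]_t gE^\-%E (vec_of t))%E \is a fin_num.
  have := integrable_neg_fin_num measurableT ig.
  by rewrite (funeneg_comp gE (@vec_of R n)).
have inv (x y : \bar R) : (`|\det A|%:E * x = y)%E -> x = (`|\det A|^-1%:E * y)%E.
  by move=> <-; rewrite muleA -EFinM mulVf // mul1e.
rewrite /Rintegral [X in _ * fine X]integralE [X in _ = fine X]integralE.
rewrite (funepos_comp gE (fun t => vec_of t *m A + b)) (funepos_comp gE (@vec_of R n)).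
rewrite (funeneg_comp gE (fun t => vec_of t *m A + b)) (funeneg_comp gE (@vec_of R n)).
rewrite (inv _ _ hp) (inv _ _ hn).
rewrite -(fineK fp) -(fineK fn) -!EFinM -!EFinD /= -mulrBr mulrA.
by rewrite divff // mul1r.
Qed.

Lemma simplex_point_affine n d (V : 'I_n.+1 -> 'rV[R]_d) (g : 'rV[R]_d -> R) :
  polyfun g -> polyfun (g \o simplex_point V).
Proof. exact: polyfun_affine. Qed.

Lemma simplex_integral_perm n d (V : 'I_n.+1 -> 'rV[R]_d) (s : 'S_n.+1) g :
  polyfun g -> simplex_integral (V \o s) g = simplex_integral V g.
Proof.
move=> pg.
pose h := ref_restrict (g \o simplex_point V).
have ph := simplex_point_affine V pg.
have := integral_affine (ref_vtx R (s ord0)) (edge_perm_unit R s)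
  (measurable_ref_restrict ph) (integrable_ref_restrict ph).
rewrite det_edge_perm mul1r integral_ref_restrict => E.
rewrite /simplex_integral; apply: etrans E.
rewrite [LHS]Rintegral_mkcond; apply: eq_Rintegral => t _.
rewrite /ref_restrict !patchE tuple_of_rowK.
have [h1 h2] := ref_perm s (vec_of t); rewrite vec_ofK in h1 h2.
have -> : (tuple_of_row (vec_of t *m edge_mx (ref_vtx R (n:=n) \o s) + ref_vtx R (s ord0))
   \in ref n) = (t \in ref n).
  by apply/idP/idP; rewrite !inE => ?; auto.
by case: ifP => // _; rewrite simplex_point_comp.
Qed.

End change_of_variables.

(** * Integration along an edge *)

Section slices.
Context (R : realType) (d : nat).
Local Notation RR := (measurableTypeR R).
Local Notation L := (lebesgue_tuple R).
Local Notation ref n := (@ref_simplex R n).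
Local Notation mu := (@lebesgue_measure R).

Lemma polyfun_line (g : 'rV[R]_d -> R) (P e : 'rV[R]_d) (y : R) : polyfun g ->
  is_derive y 1 (fun s : R => g (P + s *: e)) ('D_e g (P + y *: e)).
Proof.
move=> pg; have [dg _] := polyfun_derive e pg.
have E : (fun h : R => h^-1 *: (g (P + (h *: (1 : R) + y) *: e) - g (P + y *: e))) =
         (fun h : R => h^-1 *: (g (h *: e + (P + y *: e)) - g (P + y *: e))).
  apply/funext => h; congr (_ *: (g _ - _)).
  have -> : h *: (1 : R) = h by exact: mulr1.
  by rewrite scalerDl addrCA.
have := dg (P + y *: e); rewrite /derivable => dgy.
split; first by rewrite /derivable E.
by rewrite /derive E.
Qed.

Lemma integral_polyfun_line (g : 'rV[R]_d -> R) (P e : 'rV[R]_d) (c : R) :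
  polyfun g -> 0 <= c ->
  (\int[mu]_(y in [set` `[0%R, c]]) ('D_e g (P + y *: e)%R)%:E =
   (g (P + c *: e)%R)%:E - (g P)%:E)%E.
Proof.
move=> pg; rewrite le_eqVlt => /predU1P[<-|c0].
  by rewrite scale0r addr0 set_itv1 integral_set1 subee.
have [dg pdg] := polyfun_derive e pg.
have ch (f : 'rV[R]_d -> R) : polyfun f -> continuous (fun s : R => f (P + s *: e)).
  move=> pf s.
  apply: differentiable_continuous; apply/derivable1_diffP.
  by case: (polyfun_line P e s pf).
rewrite (@continuous_FTC2 R _ (fun s : R => g (P + s *: e))) //.
- by rewrite scale0r addr0.
- exact: continuous_subspaceT (ch _ pdg).
- split.
  + by move=> y _; case: (polyfun_line P e y pg).
  + by apply: cvg_at_right_filter; exact: ch.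
  + by apply: cvg_at_left_filter; exact: ch.
- move=> y _; rewrite derive1E; have H := polyfun_line P e y pg.
  by rewrite derive_val.
Qed.

(** The slice of the reference simplex above x is an interval. *)
Lemma ref_cons n (x : n.-tuple RR) (y : RR) :
  ref n.+1 (cons_tuple (x, y)) <->
  ref n x /\ 0 <= y <= 1 - \sum_i tnth x i.
Proof.
rewrite /ref_simplex /=; have -> : \sum_(i < n.+1) tnth (cons_tuple (x, y)) i =
   y + \sum_i tnth x i.
  by rewrite big_ord_recl tnth0; congr (_ + _); apply: eq_bigr => i _; rewrite tnthS.
have H := @cons_tuple_forall R n (fun _ z => 0 <= z) x y.
split=> [[/H [y0 x0] s1]|[[x0 x1] /andP[y0 y1]]].
  split; first by split => //; lra.
  by rewrite y0 lerBrDr.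
by split; [apply/H|lra].
Qed.

Lemma simplex_point_cons n (V : 'I_n.+2 -> 'rV[R]_d) (x : n.-tuple RR) (y : RR) :
  simplex_point V (vec_of (cons_tuple (x, y))) =
  simplex_point (V \o lift (lift ord0 ord0)) (vec_of x) +
    y *: (V (lift ord0 ord0) - V ord0).
Proof.
have l10 : lift (lift ord0 ord0 : 'I_n.+2) ord0 = ord0 by apply/val_inj.
rewrite /simplex_point [RHS]addrAC /= l10; congr (_ + _).
rewrite !mulmx_sum_row big_ord_recl addrC; congr (_ + _).
  by rewrite rowK mxE tnth0.
apply: eq_bigr => i _; rewrite !rowK !mxE tnthS /= l10; congr (_ *: (V _ - _)).
by apply/val_inj.
Qed.

Lemma simplex_point_top n (V : 'I_n.+2 -> 'rV[R]_d) (x : 'rV[R]_n) :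
  simplex_point (V \o lift ord0) x =
  simplex_point (V \o lift (lift ord0 ord0)) x +
    (1 - \sum_i x 0 i) *: (V (lift ord0 ord0) - V ord0).
Proof.
have l10 : lift (lift ord0 ord0 : 'I_n.+2) ord0 = ord0 by apply/val_inj.
have lS j : lift (lift ord0 ord0 : 'I_n.+2) (lift ord0 j) = lift ord0 (lift ord0 j).
  by apply/val_inj.
rewrite !simplex_pointE big_ord_recl [in RHS]big_ord_recl !bary0 /= l10.
under [X in _ = _ + X + _]eq_bigr do rewrite /= lS.
by rewrite addrAC -scalerDr addrCA subrr addr0.
Qed.

(** [V \o lift ord0] and [V \o lift (lift ord0 ord0)] are the facets opposite to
    the vertices 0 and 1. *)
Lemma simplex_integral_FTC n (V : 'I_n.+2 -> 'rV[R]_d) g : polyfun g ->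
  simplex_integral V ('D_(V (lift ord0 ord0) - V ord0) g) =
  simplex_integral (V \o lift ord0) g -
  simplex_integral (V \o lift (lift ord0 ord0)) g.
Proof.
move=> pg; set e := V _ - V _; have [dg pdg] := polyfun_derive e pg.
rewrite /simplex_integral -RintegralB; last 3 first.
- exact: measurable_ref.
- exact: integrable_ref (simplex_point_affine _ pg).
- exact: integrable_ref (simplex_point_affine _ pg).
rewrite /Rintegral; congr fine.
rewrite integral_mkcond integral_cons1; last first.
  apply/(integrable_mkcond _ (@measurable_ref R n.+1)).
  exact: integrable_ref (simplex_point_affine _ pdg).
rewrite [RHS]integral_mkcond; apply: eq_integral => x _.
rewrite patchE; case: ifPn => [|nx].
  rewrite inE => rx.
  have c0 : 0 <= 1 - \sum_i tnth x i by case: rx => _; rewrite subr_ge0.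
  have := integral_polyfun_line (simplex_point (V \o lift (lift ord0 ord0)) (vec_of x)) e pg c0.
  rewrite EFinD EFinN simplex_point_top -/e.
  under [\sum_i vec_of x 0 i]eq_bigr do rewrite mxE.
  move=> <-; rewrite [RHS]integral_mkcond; apply: eq_integral => y _.
  rewrite !patchE.
  have -> : (cons_tuple (x, y) \in ref n.+1) = (y \in [set` `[0%R, 1 - \sum_i tnth x i]]).
    apply/idP/idP; rewrite !inE; first by move=> /ref_cons[_] hy; rewrite /= in_itv.
    by rewrite /= in_itv /= => hy; apply/ref_cons.
  by case: ifP => // _; rewrite simplex_point_cons.
rewrite integral0_eq // => y _; rewrite patchE ifN //.
by apply: contraNN nx; rewrite !inE => /ref_cons[].
Qed.

End slices.

Section simplex_integral_linear.
Context (R : realType) (d n : nat) (V : 'I_n.+1 -> 'rV[R]_d).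
Local Notation L := (lebesgue_tuple R).

Lemma simplex_integralD f g : polyfun f -> polyfun g ->
  simplex_integral V (fun x => f x + g x) = simplex_integral V f + simplex_integral V g.
Proof.
move=> pf pg; apply: RintegralD; first exact: measurable_ref.
  exact: integrable_ref (simplex_point_affine _ pf).
exact: integrable_ref (simplex_point_affine _ pg).
Qed.

Lemma simplex_integralZ c f : polyfun f ->
  simplex_integral V (fun x => c * f x) = c * simplex_integral V f.
Proof.
move=> pf; apply: RintegralZl; first exact: measurable_ref.
exact: integrable_ref (simplex_point_affine _ pf).
Qed.

Lemma simplex_integral0 : simplex_integral V (fun _ => 0) = 0.
Proof. by rewrite /simplex_integral Rintegral_cst ?mul0r //; exact: measurable_ref. Qed.

Lemma simplex_integral_sum I (r : seq I) (f : I -> 'rV[R]_d -> R) :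
  (forall i, polyfun (f i)) ->
  simplex_integral V (fun x => \sum_(i <- r) f i x) =
  \sum_(i <- r) simplex_integral V (f i).
Proof.
move=> pf; elim: r => [|i r IHr].
  by rewrite big_nil; under eq_fun do rewrite big_nil; exact: simplex_integral0.
rewrite big_cons -IHr; under eq_fun do rewrite big_cons.
by apply: simplex_integralD => //; exact: polyfun_sum.
Qed.

End simplex_integral_linear.

Section polynomial_differentiable.
Context (R : realType) (d : nat).

Lemma polyfun_differentiable (g : 'rV[R]_d -> R) x : polyfun g -> differentiable g x.
Proof.
elim/polyfun_ind => [c|i|f h _ _ df dh|f h _ _ df dh].
- exact: differentiable_cst.
- exact: differentiable_coord.
- exact: (differentiableD df dh).
- exact: (differentiableM df dh).
Qed.

Lemma derive_sum_direction I (r : seq I) (c : I -> R) (v : I -> 'rV[R]_d) g x :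
  polyfun g ->
  'D_(\sum_(i <- r) c i *: v i) g x = \sum_(i <- r) c i * 'D_(v i) g x.
Proof.
move=> pg; have dg := polyfun_differentiable x pg.
rewrite deriveE // linear_sum; apply: eq_bigr => i _.
by rewrite linearZ deriveE.
Qed.

End polynomial_differentiable.

(** * The divergence theorem on a simplex *)

Section dot_product.
Context (R : realType).

Lemma dotC m (x y : 'rV[R]_m) : dot x y = dot y x.
Proof. by apply: eq_bigr => i _; rewrite mulrC. Qed.

Lemma dotE m (x y : 'rV[R]_m) : dot x y = (x *m y^T) 0 0.
Proof. by rewrite mxE; apply: eq_bigr => i _; rewrite mxE. Qed.

Lemma dotDr m (x y z : 'rV[R]_m) : dot x (y + z) = dot x y + dot x z.
Proof. by rewrite !dotE linearD mulmxDr mxE. Qed.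

Lemma dotNr m (x y : 'rV[R]_m) : dot x (- y) = - dot x y.
Proof. by rewrite !dotE linearN mulmxN mxE. Qed.

Lemma dotZr m c (x y : 'rV[R]_m) : dot x (c *: y) = c * dot x y.
Proof. by rewrite !dotE linearZ -scalemxAr mxE. Qed.

Lemma dotDl m (x y z : 'rV[R]_m) : dot (y + z) x = dot y x + dot z x.
Proof. by rewrite !(dotC _ x) dotDr. Qed.

Lemma dotZl m c (x y : 'rV[R]_m) : dot (c *: y) x = c * dot y x.
Proof. by rewrite !(dotC _ x) dotZr. Qed.

Lemma dotNl m (x y : 'rV[R]_m) : dot (- y) x = - dot y x.
Proof. by rewrite !(dotC _ x) dotNr. Qed.

Lemma dot_ge0 m (x : 'rV[R]_m) : 0 <= dot x x.
Proof. by apply: sumr_ge0 => i _; exact: sqr_ge0. Qed.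

Lemma dot_eq0 m (x : 'rV[R]_m) : (dot x x == 0) = (x == 0).
Proof.
apply/eqP/eqP => [|->]; last by rewrite /dot big1 // => i _; rewrite mxE mul0r.
move=> h; apply/rowP => i; rewrite mxE.
have := @psumr_eq0P _ _ xpredT (fun i => x 0 i * x 0 i) (fun i _ => sqr_ge0 _) h i isT.
by move/eqP; rewrite mulf_eq0 orbb => /eqP.
Qed.

Lemma dot_suml I (r : seq I) (P : pred I) m (f : I -> 'rV[R]_m) x :
  dot (\sum_(i <- r | P i) f i) x = \sum_(i <- r | P i) dot (f i) x.
Proof. by rewrite dotE mulmx_suml summxE; under [RHS]eq_bigr do rewrite dotE. Qed.

End dot_product.

Section simplex_geometry.
Context (R : realType) (n : nat) (V : 'I_n.+2 -> 'rV[R]_n.+1).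
Context (V_free : edge_mx V \in unitmx).
Local Notation E := (edge_mx V).

(** The gradients of the barycentric coordinates of the simplex V: the columns of
    the inverse of the edge matrix, and minus their sum for the vertex 0. *)
Definition bary_grad (j : 'I_n.+2) : 'rV[R]_n.+1 :=
  if unlift ord0 j is Some j' then (col j' (invmx E))^T
  else - \sum_j' (col j' (invmx E))^T.

Lemma bary_gradS j : bary_grad (lift ord0 j) = (col j (invmx E))^T.
Proof. by rewrite /bary_grad liftK. Qed.

Lemma bary_grad0 : bary_grad ord0 = - \sum_j bary_grad (lift ord0 j).
Proof. by rewrite {1}/bary_grad unlift_none; under [in RHS]eq_bigr do rewrite bary_gradS. Qed.

Lemma dot_bary_grad0 j i :
  dot (bary_grad j) (V i - V ord0) = (i == j)%:R - (ord0 == j)%:R.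
Proof.
have H j' i' : dot (bary_grad (lift ord0 j')) (V (lift ord0 i') - V ord0) = (i' == j')%:R.
  transitivity ((E *m invmx E) i' j'); last by rewrite mulmxV // mxE.
  rewrite bary_gradS mxE; apply: eq_bigr => k _.
  by rewrite !mxE mulrC.
have H0 : dot (bary_grad j) 0 = 0 by rewrite dotE trmx0 mulmx0 mxE.
case: (unliftP ord0 i) => [i' ->|->]; last by rewrite !subrr.
case: (unliftP ord0 j) => [j' ->|->].
  by rewrite H (inj_eq lift_inj) (negPf (neq_lift _ _)) subr0.
rewrite bary_grad0 dotNl dot_suml (bigD1 i') //= H eqxx big1 ?addr0; last first.
  by move=> k ki; rewrite H eq_sym (negPf ki).
by rewrite sub0r.
Qed.

Lemma dot_bary_grad j i l :
  dot (bary_grad j) (V i - V l) = (i == j)%:R - (l == j)%:R.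
Proof.
have -> : V i - V l = (V i - V ord0) - (V l - V ord0) by rewrite opprB addrA subrK.
by rewrite dotDr dotNr !dot_bary_grad0 opprB addrA subrK.
Qed.

Lemma dot_edges_eq0 (w : 'rV[R]_n.+1) :
  (forall i, dot w (V i - V ord0) = 0) -> w = 0.
Proof.
move=> h; have : E *m w^T = 0.
  apply/colP => j; rewrite [RHS]mxE mxE -[RHS](h (lift ord0 j)).
  by apply: eq_bigr => k _; rewrite !mxE mulrC.
move/(congr1 (mulmx (invmx E))); rewrite mulmxA mulVmx // mul1mx mulmx0.
by move/(congr1 trmx); rewrite trmxK trmx0.
Qed.

Lemma bary_grad_neq0 j : bary_grad j != 0.
Proof.
apply/eqP => m0; have := dot_bary_grad j j (lift j ord0).
rewrite m0 eqxx eq_sym (negPf (neq_lift _ _)) subr0 /dot big1 => [/eqP|i _].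
  by rewrite eq_sym oner_eq0.
by rewrite mxE mul0r.
Qed.

(** The standard basis decomposed on the edges issued from [V ord0]. *)
Lemma delta_edges (i : 'I_n.+1) :
  delta_mx 0 i = \sum_j bary_grad (lift ord0 j) 0 i *: (V (lift ord0 j) - V ord0).
Proof.
have := mulVmx V_free => /(congr1 (row i)).
rewrite row1 row_mul mulmx_sum_row => <-; apply: eq_bigr => j _.
by rewrite rowK bary_gradS !mxE.
Qed.

(** The scalar product of the field with components w and of the vector m. *)
Definition row_fun (w : 'I_n.+1 -> 'rV[R]_n.+1 -> R) (m : 'rV[R]_n.+1) x :=
  \sum_i w i x * m 0 i.

Lemma polyfun_row_fun w m : (forall i, polyfun (w i)) -> polyfun (row_fun w m).
Proof.
by move=> pw; apply: polyfun_sum => i; apply: polyfunM => //; exact: polyfun_cst.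
Qed.

Lemma derive_row_fun w m v x : (forall i, polyfun (w i)) ->
  'D_v (row_fun w m) x = \sum_i m 0 i * 'D_v (w i) x.
Proof.
move=> pw; rewrite /row_fun.
have H i : is_derive x v (fun y => w i y * m 0 i) (m 0 i * 'D_v (w i) x).
  have dw : derivable (w i) x v by exact: (polyfun_derive v (pw i)).1.
  have h := @derivableP _ _ _ _ _ _ dw.
  have -> : (fun y => w i y * m 0 i) = m 0 i \*: w i.
    by apply/funext => y; rewrite /= mulrC.
  exact: is_deriveZ.
have -> : (fun y => \sum_i w i y * m 0 i) = \sum_i (fun y => w i y * m 0 i).
  by apply/funext => y; rewrite fct_sumE.
by rewrite derive_val.
Qed.

Lemma divergence_edges w x : (forall i, polyfun (w i)) ->
  \sum_i 'D_(delta_mx 0 i) (w i) x =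
  \sum_j 'D_(V (lift ord0 j) - V ord0) (row_fun w (bary_grad (lift ord0 j))) x.
Proof.
move=> pw; under eq_bigr do rewrite delta_edges derive_sum_direction //.
rewrite exchange_big /=; apply: eq_bigr => j _.
by rewrite derive_row_fun.
Qed.

Lemma simplex_integral_FTC_gen (j : 'I_n.+1) g : polyfun g ->
  simplex_integral V ('D_(V (lift ord0 j) - V ord0) g) =
  simplex_integral (V \o lift ord0) g - simplex_integral (V \o lift (lift ord0 j)) g.
Proof.
move=> pg.
(* the vertex j is moved to position 1, the order of the others is kept *)
pose s : 'S_n.+2 := lift_perm (lift ord0 ord0) (lift ord0 j) 1.
have l0 (k : 'I_n.+1) : lift (lift ord0 k : 'I_n.+2) ord0 = ord0 by apply/val_inj.
have s1 : s (lift ord0 ord0) = lift ord0 j by rewrite /s lift_perm_id.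
have s0 : s ord0 = ord0.
  by rewrite -{1}(l0 ord0) /s lift_perm_lift perm1 l0.
have [_ pdg] := polyfun_derive (V (lift ord0 j) - V ord0) pg.
rewrite -(simplex_integral_perm V s pdg).
have := simplex_integral_FTC (V \o s) pg; rewrite /= s0 s1 => ->.
congr (_ - _).
- pose f (k : 'I_n.+1) := odflt k (unlift ord0 (s (lift ord0 k))).
  have fE k : lift ord0 (f k) = s (lift ord0 k).
    rewrite /f; case: unliftP => [k' ->//|h].
    by have := neq_lift ord0 k; rewrite -(inj_eq (@perm_inj _ s)) s0 h eqxx.
  have f_inj : injective f.
    by move=> k k' /(congr1 (lift ord0)); rewrite !fE => /perm_inj/lift_inj.
  rewrite -(simplex_integral_perm (V \o lift ord0) (perm f_inj) pg).
  by congr (simplex_integral _ g); apply/funext => k /=; rewrite -fE -(permE f_inj).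
- by congr (simplex_integral _ g); apply/funext => k /=; rewrite /s lift_perm_lift perm1.
Qed.

Lemma simplex_integral_divergence w : (forall i, polyfun (w i)) ->
  simplex_integral V (fun x => \sum_i 'D_(delta_mx 0 i) (w i) x) =
  - \sum_j simplex_integral (V \o lift j) (row_fun w (bary_grad j)).
Proof.
move=> pw; have pr m := polyfun_row_fun m pw.
under eq_fun do rewrite divergence_edges //.
rewrite simplex_integral_sum; last by move=> j; exact: (polyfun_derive _ (pr _)).2.
under eq_bigr do rewrite simplex_integral_FTC_gen //.
rewrite big_split /= sumrN [in RHS]big_ord_recl opprD; congr (_ - _).
rewrite -simplex_integral_sum // -mulN1r -simplex_integralZ //.
congr simplex_integral; apply/funext => x.
rewrite mulN1r bary_grad0 /row_fun -sumrN exchange_big /=.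
by apply: eq_bigr => i _; rewrite mxE summxE mulrN opprK mulr_sumr.
Qed.

(** Let W be an edge matrix of the simplex with first row r, an edge ending at
    V j, and other rows B, the edges of the opposite facet; let C be W with r
    replaced by m = bary_grad j.  As m is orthogonal to B and m . r = 1, we have
    det C = |m|^2 det W, and C C^T is block diagonal with blocks |m|^2, B B^T. *)
Lemma gram_facet j :
  \det (edge_mx (V \o lift j) *m (edge_mx (V \o lift j))^T) =
  (\det E) ^+ 2 * dot (bary_grad j) (bary_grad j).
Proof.
pose s : 'S_n.+2 := lift_perm (lift ord0 ord0) j 1.
pose W : 'M[R]_(1 + n, n.+1) := edge_mx (V \o s).
pose B := edge_mx (V \o lift j); pose m := bary_grad j.
pose r := V j - V (lift j ord0).
have l10 : lift (lift ord0 ord0 : 'I_n.+2) ord0 = ord0 by apply/val_inj.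
have s1 : s (lift ord0 ord0) = j by rewrite /s lift_perm_id.
have sl k : s (lift (lift ord0 ord0) k) = lift j k by rewrite /s lift_perm_lift perm1.
have s0 : s ord0 = lift j ord0 by rewrite -sl l10.
have WE : W = col_mx r B.
  apply/row_matrixP => k; rewrite rowK /= s0; case: (unliftP ord0 k) => [k' ->|->].
    have -> : lift ord0 k' = rshift 1 k' :> 'I_(1 + n) by apply/val_inj.
    rewrite rowKd rowK /= -!sl; congr (V (s _) - _).
    by apply/val_inj.
  have {3}-> : ord0 = lshift n (ord0 : 'I_1) by apply/val_inj.
  by rewrite s1 rowKu -/r; apply/rowP => k0; rewrite !mxE.
have dW : (\det (W : 'M[R]_n.+1)) ^+ 2 = (\det E) ^+ 2.
  rewrite /W edge_mx_comp det_mulmx exprMn -[X in X * _]real_normK ?num_real //.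
  by rewrite det_edge_perm expr1n mul1r.
have Wu : (W : 'M[R]_n.+1) \in unitmx.
  by rewrite /W edge_mx_comp unitmx_mul edge_perm_unit.
have mB : m *m B^T = 0.
  apply/rowP => k; rewrite [RHS]mxE !mxE.
  have := dot_bary_grad j (lift j (lift ord0 k)) (lift j ord0).
  rewrite !(eq_sym _ j) !(negPf (neq_lift _ _)) subrr; apply: etrans.
  by apply: eq_bigr => i _; rewrite !mxE.
have mr : dot m r = 1.
  by rewrite dot_bary_grad eqxx eq_sym (negPf (neq_lift _ _)) subr0.
pose c : 'rV[R]_(1 + n) := m *m invmx (W : 'M[R]_n.+1).
have mE : m = (lsubmx c) *m r + (rsubmx c) *m B.
  by rewrite -mul_row_col hsubmxK -WE /c mulmxKV.
have cE : lsubmx c = (dot m m)%:M.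
  rewrite [LHS]mx11_scalar; congr _%:M.
  rewrite {2}mE dotDr (mx11_scalar (lsubmx c)) mul_scalar_mx dotZr mr mulr1.
  rewrite [X in _ = _ + X]dotE trmx_mul mulmxA mB mul0mx [X in _ = _ + X]mxE addr0.
  by rewrite mxE eqxx mulr1n.
pose C : 'M[R]_(1 + n, n.+1) := col_mx m B.
have CE : C = block_mx (dot m m)%:M (rsubmx c) 0 1%:M *m W.
  by rewrite WE mul_block_col mul0mx add0r mul1mx -cE -mE.
have dC : \det (C : 'M[R]_n.+1) = dot m m * \det (W : 'M[R]_n.+1).
  rewrite CE; apply: etrans (det_mulmx (block_mx _ _ _ _ : 'M[R]_(1 + n)) W) _.
  by rewrite det_ublock det_scalar1 det1 mulr1.
have CC : C *m C^T = block_mx (dot m m)%:M 0 0 (B *m B^T).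
  rewrite /C tr_col_mx mul_col_row mB; congr block_mx.
    by rewrite [LHS]mx11_scalar dotE.
  by rewrite -[B *m _]trmxK trmx_mul trmxK mB trmx0.
have : \det (C *m C^T) = (dot m m * \det (W : 'M[R]_n.+1)) ^+ 2.
  apply: etrans (det_mulmx (C : 'M[R]_n.+1) C^T) _.
  by rewrite det_tr dC expr2.
rewrite CC det_ublock det_scalar1 exprMn dW => h.
have m0 : dot m m != 0 by rewrite dot_eq0 bary_grad_neq0.
by apply: (mulfI m0); rewrite h; ring.
Qed.

End simplex_geometry.

(** * Vertices and facets of mesh simplices *)

Section mesh_simplices.
Context (R : realType) (d : nat) (M : mesh R d).
Implicit Types (A K F : simplex M).

(** The k-th vertex of A, in the order used by [edges] and [param]. *)
Definition vertex_of m A (k : 'I_m.+1) : 'rV[R]_d := nth 0 (vertices A) k.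

Lemma edgesE m A : edges m A = edge_mx (@vertex_of m A).
Proof. by apply/row_matrixP => j; rewrite !rowK /vertex_of /origin. Qed.

Lemma paramE m A (t : m.-tuple (measurableTypeR R)) :
  param A t = simplex_point (@vertex_of m A) (vec_of t).
Proof. by rewrite /param edgesE addrC. Qed.

(** The index of the k-th vertex of A. *)
Definition vidx m A (cA : #|A| = m.+1) (k : 'I_m.+1) : 'I_(nvert M) :=
  enum_val (cast_ord (esym cA) k).

Section vertex_index.
Context (m : nat) (A : simplex M) (cA : #|A| = m.+1).

Lemma vidx_inj : injective (vidx cA).
Proof. by move=> i j /enum_val_inj/cast_ord_inj. Qed.

Lemma vidx_in k : vidx cA k \in A.
Proof. exact: enum_valP. Qed.

Lemma vidx_onto i : i \in A -> exists k, i = vidx cA k.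
Proof.
move=> iA; exists (cast_ord cA (enum_rank_in iA i)).
by rewrite /vidx cast_ordK enum_rankK_in.
Qed.

Lemma vidxP i : reflect (exists k, i = vidx cA k) (i \in A).
Proof. by apply: (iffP idP) => [/vidx_onto //|[k ->]]; exact: vidx_in. Qed.

Lemma nth_vidx x0 (k : 'I_m.+1) : nth x0 (enum A) k = vidx cA k.
Proof. by rewrite /vidx (enum_val_nth x0). Qed.

Lemma vertex_ofE k : vertex_of A k = vtx (vidx cA k).
Proof.
by rewrite /vertex_of /vertices (nth_map (vidx cA k)) ?nth_vidx // -cardE cA.
Qed.

Lemma sum_vidx (V : nmodType) (F : 'I_(nvert M) -> V) :
  \sum_(i in A) F i = \sum_k F (vidx cA k).
Proof.
transitivity (\sum_(i in vidx cA @: 'I_m.+1) F i).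
  by apply: eq_bigl => i; apply/vidxP/imsetP => [[k ->]|[k _ ->]]; exists k.
by rewrite big_imset //= => i j _ _; exact: vidx_inj.
Qed.

Lemma sum_vidx_supp (V : nmodType) (F : 'I_(nvert M) -> V) :
  (forall i, i \notin A -> F i = 0) -> \sum_i F i = \sum_k F (vidx cA k).
Proof.
by move=> F0; rewrite -sum_vidx [LHS](bigID (mem A)) /= [X in _ + X]big1 ?addr0.
Qed.

Lemma hullP x : hull A x <->
  exists2 y : 'rV[R]_m, forall k, 0 <= bary y k & x = simplex_point (@vertex_of m A) y.
Proof.
split=> [[w [w0 wA w1 ->]]|[y y0 ->]].
  pose y : 'rV[R]_m := \row_k w (vidx cA (lift ord0 k)).
  have yE k : bary y k = w (vidx cA k).
    case: (unliftP ord0 k) => [k' ->|->]; first by rewrite baryS mxE.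
    rewrite bary0 -w1 sum_vidx_supp // big_ord_recl.
    by under [X in _ - X]eq_bigr do rewrite mxE; rewrite addrK.
  exists y => [k|]; first by rewrite yE.
  rewrite simplex_pointE sum_vidx_supp => [|i iA]; last by rewrite wA // scale0r.
  by apply: eq_bigr => k _; rewrite yE vertex_ofE.
pose w i := \sum_(k | vidx cA k == i) bary y k.
have wE k : w (vidx cA k) = bary y k.
  rewrite /w (bigD1 k) //= big1 ?addr0 // => k' /andP[/eqP/vidx_inj ->].
  by rewrite eqxx.
have w0 i : i \notin A -> w i = 0.
  move=> iA; rewrite /w big_pred0 // => k; apply: contraNF iA => /eqP <-.
  exact: vidx_in.
exists w; split=> //.
- by move=> i; apply: sumr_ge0.
- by rewrite sum_vidx_supp // -[RHS](bary_sum y); apply: eq_bigr => k _; rewrite wE.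
- rewrite sum_vidx_supp => [|i iA]; last by rewrite w0 // scale0r.
  by rewrite simplex_pointE; apply: eq_bigr => k _; rewrite wE vertex_ofE.
Qed.

End vertex_index.

Lemma card_facet m K (cK : #|K| = m.+2) j : #|K :\ vidx cK j| = m.+1.
Proof. by apply: succn_inj; rewrite -cK (cardsD1 (vidx cK j) K) vidx_in. Qed.

(** Removing the j-th vertex does not change the order of the other ones. *)
Lemma vertex_of_facet m K (cK : #|K| = m.+2) j (k : 'I_m.+1) :
  vertex_of (K :\ vidx cK j) k = vertex_of K (lift j k).
Proof.
rewrite (vertex_ofE (card_facet cK j)) (vertex_ofE cK); congr vtx.
rewrite -(nth_vidx _ (vidx cK j)) -(nth_vidx cK (vidx cK j) (lift j k)).
have jK : index (vidx cK j) (enum K) = j.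
  by rewrite -(nth_vidx cK (vidx cK j)) index_uniq ?enum_uniq // -cardE cK.
have -> : enum (K :\ vidx cK j) = rem (vidx cK j) (enum K).
  rewrite rem_filter ?enum_uniq // /(enum _) -filter_predI.
  by apply: eq_filter => i; rewrite !inE.
rewrite remE jK nth_cat size_take -cardE cK ltn_ord /= /bump.
case: (ltnP k j) => h; first by rewrite nth_take.
by rewrite nth_drop add1n addSn subnKC.
Qed.

Lemma facets_ofP m K (cK : #|K| = m.+2) F : d = m.+1 ->
  reflect (exists j, F = K :\ vidx cK j) (F \in facets_of K).
Proof.
move=> dm; rewrite inE [X in _ == X]dm; apply: (iffP andP) => [[FK /eqP cF]|[j ->]]; last first.
  by rewrite subD1set card_facet.
have : #|K :\: F| = 1%N by rewrite cardsDS // cK cF subSnn.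
move/eqP/cards1P => [i KF].
have iK : i \in K by have := set11 i; rewrite -KF inE => /andP[].
have [j ji] := vidx_onto cK iK; exists j; rewrite -ji -KF.
by rewrite finset.setDDr finset.setDv finset.set0U; apply/esym/finset.setIidPr.
Qed.

Lemma sum_facets m K (cK : #|K| = m.+2) (f : simplex M -> R) : d = m.+1 ->
  \sum_(F in facets_of K) f F = \sum_j f (K :\ vidx cK j).
Proof.
move=> dm; have inj : injective (fun j => K :\ vidx cK j).
  move=> i j /setP /(_ (vidx cK i)); rewrite !inE eqxx vidx_in andbT /=.
  by rewrite andbT => /esym/negbFE /eqP h; exact: (vidx_inj h).
transitivity (\sum_(F in (fun j => K :\ vidx cK j) @: 'I_m.+2) f F).
  by apply: eq_bigl => F; apply/(facets_ofP cK F dm)/imsetP => [[j ->]|[j _ ->]]; exists j.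
by rewrite big_imset //= => i j _ _; exact: inj.
Qed.

End mesh_simplices.

(** * The divergence theorem on a cell *)

Section mesh_divergence.
Context (R : realType) (n : nat) (M : mesh R n.+1).
Implicit Types (K F : simplex M).
Local Notation RR := (measurableTypeR R).
Local Notation L := (lebesgue_tuple R).
Local Notation ref n := (@ref_simplex R n).

Lemma facet_integralE F g :
  facet_integral F setT g =
  Num.sqrt (\det (edge_mx (@vertex_of _ _ M n F) *m (edge_mx (@vertex_of _ _ M n F))^T)) *
  simplex_integral (@vertex_of _ _ M n F) g.
Proof.
rewrite /facet_integral edgesE; congr (_ * _).
rewrite /simplex_integral /facet_part setIT.
by apply: eq_Rintegral => t _; rewrite paramE.
Qed.

Lemma nondegenerate_unit K (cK : #|K| = n.+2) :
  nondegenerate K -> edge_mx (@vertex_of _ _ M n.+1 K) \in unitmx.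
Proof. by move=> [_]; rewrite edgesE row_free_unit. Qed.

Lemma volume_integralE K g : nondegenerate K -> polyfun g ->
  volume_integral (hull K) g =
  `|\det (edge_mx (@vertex_of _ _ M n.+1 K))| *
  simplex_integral (@vertex_of _ _ M n.+1 K) g.
Proof.
move=> ndK pg; have cK : #|K| = n.+2 by case: ndK.
set V := vertex_of K; have Vu : edge_mx V \in unitmx by exact: nondegenerate_unit.
have pV := simplex_point_affine V pg.
pose b := - (V ord0 *m invmx (edge_mx V)).
have iVu : invmx (edge_mx V) \in unitmx by rewrite unitmx_inv.
have := integral_affine b iVu (measurable_ref_restrict pV) (integrable_ref_restrict pV).
rewrite det_inv normfV integral_ref_restrict => H.
have dV : `|\det (edge_mx V)| != 0.
  by rewrite normr_eq0 -unitfE -unitmxE.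
rewrite /simplex_integral -H mulrA divff // mul1r /volume_integral Rintegral_mkcond.
apply: eq_Rintegral => t _; rewrite /ref_restrict !patchE.
set y := vec_of t *m _ + b.
have yE : simplex_point V y = vec_of t.
  by rewrite /simplex_point /y /b mulmxDl mulNmx !mulmxKV // subrK.
rewrite tuple_of_rowK /= yE.
have -> // : (tuple_of_row y \in ref n.+1) = (t \in [set t | hull K (vec_of t)]).
apply/idP/idP; rewrite !inE /=.
  by move=> ry; apply/(hullP cK); exists y => // k; move: k; apply/refP.
move=> /(hullP cK)[z z0 zE]; suff -> : y = z by apply/refP.
by rewrite /y zE /simplex_point mulmxDl mulmxK // /b addrK.
Qed.

Lemma normalE K (cK : #|K| = n.+2) j : nondegenerate K ->
  normal K (K :\ vidx cK j) =
  - ((Num.sqrt (dot (bary_grad (@vertex_of _ _ M n.+1 K) j)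
                    (bary_grad (@vertex_of _ _ M n.+1 K) j)))^-1
     *: bary_grad (@vertex_of _ _ M n.+1 K) j).
Proof.
move=> ndK; set V := vertex_of K; set m := bary_grad V j; set c := Num.sqrt _.
have Vu : edge_mx V \in unitmx by exact: nondegenerate_unit.
have VE k : vtx (vidx cK k) = V k by rewrite /V (vertex_ofE cK).
have m0 : 0 < dot m m.
  by rewrite lt_def dot_ge0 andbT dot_eq0 bary_grad_neq0.
have c0 : 0 < c by rewrite sqrtr_gt0.
have cc : c ^+ 2 = dot m m by rewrite sqr_sqrtr // ltW.
have FP i : i \in K :\ vidx cK j -> exists2 k, k != j & i = vidx cK k.
  rewrite !inE => /andP[ij /(vidx_onto cK)[k ik]]; exists k => //.
  by apply: contraNneq ij => <-; rewrite ik.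
have FPr k : k != j -> vidx cK k \in K :\ vidx cK j.
  by move=> kj; rewrite !inE vidx_in andbT (inj_eq (@vidx_inj _ _ _ _ _ cK)).
have jP : vidx cK j \in K :\: (K :\ vidx cK j).
  by rewrite !inE eqxx vidx_in.
pose nm := - (c^-1 *: m).
have out : outward_unit_normal K (K :\ vidx cK j) nm.
  split.
  - by rewrite /nm dotNl dotNr opprK dotZl dotZr -cc; field; rewrite gt_eqF.
  - move=> i l iF lF; have [k kj ->] := FP _ iF; have [k' k'j ->] := FP _ lF.
    rewrite !VE /nm dotNl dotZl.
    by rewrite dot_bary_grad // (negPf kj) (negPf k'j) subrr mulr0 oppr0.
  - move=> i l; rewrite finset.in_setD => /andP[h iK] lF; have [k kj ->] := FP _ lF.
    have -> : i = vidx cK j by apply/eqP; move: h; rewrite !inE iK andbT negbK.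
    rewrite !VE /nm dotNl dotZl dot_bary_grad // eqxx (negPf kj) subr0 mulr1.
    by rewrite oppr_lt0 invr_gt0.
have uniq_normal w : outward_unit_normal K (K :\ vidx cK j) w -> w = nm.
  move=> [ww wF wa].
  pose k0 := lift j ord0; have k0j : k0 != j by rewrite eq_sym neq_lift.
  pose a := dot w (V j - V k0).
  have a0 : a < 0 by rewrite /a -!VE; apply: wa => //; exact: FPr.
  have wam : w - a *: m = 0.
    apply: (dot_edges_eq0 Vu) => i.
    have E2 : dot (w - a *: m) (V i - V k0) = 0.
      rewrite dotDl dotNl dotZl dot_bary_grad // (negPf k0j) subr0.
      have [->|ij] := eqVneq i j; first by rewrite mulr1 subrr.
      by rewrite mulr0 subr0 -!VE wF // FPr.
    have E3 : dot (w - a *: m) (V ord0 - V k0) = 0.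
      rewrite dotDl dotNl dotZl dot_bary_grad // (negPf k0j) subr0.
      have [->|ij] := eqVneq ord0 j; first by rewrite mulr1 subrr.
      by rewrite mulr0 subr0 -!VE wF // FPr.
    have -> : V i - V ord0 = (V i - V k0) - (V ord0 - V k0) by rewrite opprB addrA subrK.
    by rewrite dotDr dotNr E2 E3 subrr.
  have wE : w = a *: m by apply/eqP; rewrite -subr_eq0 wam.
  have ac : (a * c) ^+ 2 = 1.
    by rewrite exprMn cc -ww wE dotZl dotZr expr2 mulrA.
  have : a * c = -1.
    move/eqP: ac; rewrite sqrf_eq1 => /orP[|] /eqP // h.
    by have := nmulr_rlt0 c a0; rewrite h c0 ltr10.
  move/(canRL (mulfK (lt0r_neq0 c0))) => aE.
  by rewrite wE /nm aE mulN1r scaleNr.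
by apply: uniq_normal; apply: (@xgetPex _ 0 [set w | outward_unit_normal _ _ w]); exists nm.
Qed.

Lemma divergence_theorem K (w : 'I_n.+1 -> 'rV[R]_n.+1 -> R) :
  nondegenerate K -> (forall i, polyfun (w i)) ->
  volume_integral (hull K) (fun x => \sum_i 'D_(delta_mx 0 i) (w i) x) =
  \sum_(F in facets_of K) facet_integral F setT (row_fun w (normal K F)).
Proof.
move=> ndK pw; have cK : #|K| = n.+2 by case: ndK.
have Vu := nondegenerate_unit cK ndK.
rewrite volume_integralE //; last by apply: polyfun_sum => i; exact: (polyfun_derive _ (pw i)).2.
rewrite simplex_integral_divergence // (sum_facets cK) // mulrN mulr_sumr -sumrN.
apply: eq_bigr => j _; rewrite facet_integralE.
have -> : @vertex_of _ _ M n (K :\ vidx cK j) = vertex_of K \o lift j.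
  by apply/funext => k; exact: vertex_of_facet.
rewrite gram_facet // normalE //; set m := bary_grad _ _.
have m0 : 0 < dot m m.
  by rewrite lt_def dot_ge0 andbT dot_eq0 bary_grad_neq0.
rewrite sqrtrM ?sqr_ge0 // sqrtr_sqr -mulrA -mulrN; congr (_ * _).
set c := Num.sqrt _; have c0 : c != 0 by rewrite gt_eqF // sqrtr_gt0.
have -> : row_fun w (- (c^-1 *: m)) = (fun x => (- c^-1) * row_fun w m x).
  apply/funext => x; rewrite /row_fun mulr_sumr; apply: eq_bigr => i _.
  by rewrite !mxE; ring.
rewrite simplex_integralZ; last exact: polyfun_row_fun.
by rewrite mulrA mulrN divff // mulN1r.
Qed.

End mesh_divergence.

(** * Squares with vanishing integral *)

Section vanishing.
Context (R : realType).
Local Notation RR := (measurableTypeR R).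
Local Notation L := (lebesgue_tuple R).
Local Notation ref n := (@ref_simplex R n).

Lemma ref_bary n (t : n.-tuple RR) : ref n t <-> forall k, 0 <= bary (vec_of t) k.
Proof. by rewrite -refP vec_ofK. Qed.

(** If g y <> 0 then g^2 >= del > 0 on a copy of the reference simplex shrunk
    towards y, and this copy has positive measure. *)
Lemma ref_sqr_eq0 n (g : 'rV[R]_n -> R) : polyfun g ->
  \int[L n]_(t in ref n) (g (vec_of t) * g (vec_of t)) = 0 ->
  forall y, (forall k, 0 <= bary y k) -> g y = 0.
Proof.
move=> pg I0 y y0; apply: contrapT => /eqP gy0.
pose q x := g x * g x; have pq : polyfun q by exact: polyfunM.
have q0 x : 0 <= q x by exact: sqr_ge0.
have qy : 0 < q y by rewrite lt_def q0 andbT mulf_neq0.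
pose del := q y / 2; have del0 : 0 < del by rewrite divr_gt0.
have : \forall x \near y, del < q x.
  apply: (cvgr_gt _ (polyfun_continuous pq (x := y))).
  by rewrite /del ltr_pdivrMr // ltr_pMr // ltr1n.
move=> /nbhs_ballP[e /= e0 he].
(* points of the reference simplex are at distance at most 1 from y, so that a
   scaling ratio s < e keeps the shrunk copy in the ball of radius e *)
have y01 i : 0 <= y 0 i <= 1.
  have /refP/ref_sub_box/(_ i) := y0; by rewrite tnth_mktuple.
pose s := Num.min 1 (e / 2).
have s0 : 0 < s by rewrite lt_min ltr01 divr_gt0.
have s1 : s <= 1 by rewrite ge_min lexx.
have se : s < e by rewrite gt_min (ltr_pdivrMr _ _ (ltr0n _ 2)) ltr_pMr // ltr1n orbT.
pose T (x : 'rV[R]_n) := x *m s%:M + (1 - s) *: y.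
have TE x i : T x 0 i = s * x 0 i + (1 - s) * y 0 i by rewrite /T mul_mx_scalar !mxE.
have T_ref t : ref n t -> forall k, 0 <= bary (T (vec_of t)) k.
  move=> /ref_bary rt k.
  have -> : bary (T (vec_of t)) k = s * bary (vec_of t) k + (1 - s) * bary y k.
    case: (unliftP ord0 k) => [k' ->|->]; first by rewrite !baryS TE.
    rewrite !bary0; under eq_bigr do rewrite TE.
    by rewrite big_split /= -!mulr_sumr; ring.
  by rewrite addr_ge0 // mulr_ge0 ?(ltW s0) // subr_ge0.
have T_del t : ref n t -> del <= q (T (vec_of t)).
  move=> rt; apply/ltW/he; rewrite /ball /=; split=> // i j; rewrite (ord1 i) -ball_normE /= TE.
  have := ref_sub_box rt j; have := y01 j; rewrite mxE => /andP[a1 a2] /andP[b1 b2].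
  rewrite (_ : y 0 j - _ = s * (y 0 j - tnth t j)); last by ring.
  rewrite normrM gtr0_norm //; apply: le_lt_trans se.
  rewrite -[leRHS]mulr1 ler_wpM2l ?(ltW s0) // ler_norml; apply/andP; split; lra.
pose G (x : 'rV[R]_n) : \bar R := (ref_restrict q x)%:E.
have mG : measurable_fun setT (G \o @vec_of R n).
  by apply/measurable_EFinP; exact: measurable_ref_restrict.
have G0 x : (0 <= G x)%E by rewrite /G lee_fin /ref_restrict patchE; case: ifP.
have IG : (\int[L n]_t G (vec_of t) = 0)%E.
  have iG := integrable_fin_num measurableT (integrable_ref_restrict pq).
  rewrite -(fineK iG) -[fine _]/(\int[L n]_t ref_restrict q (vec_of t)).
  by rewrite integral_ref_restrict I0.
have Au : (s%:M : 'M[R]_n) \in unitmx.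
  by rewrite unitmxE det_scalar unitfE expf_neq0 // gt_eqF.
have := lebesgue_tuple_affine ((1 - s) *: y) Au mG G0.
rewrite IG => /eqP; rewrite mule_eq0 eqe normr_eq0 det_scalar expf_eq0 (gt_eqF s0) andbF /=.
move/eqP => IT.
have : (del%:E * L n (ref n) <= 0)%E.
  rewrite -IT -integral_cst; last exact: measurable_ref.
  rewrite integral_mkcond; apply: ge0_le_integral => //.
  - by move=> t _; rewrite patchE; case: ifP => // _; rewrite lee_fin ltW.
  - by apply/(measurable_restrictT _ (@measurable_ref R n)).
  - exact: (measurable_comp_affine _ _ mG).
  move=> t _; rewrite patchE; case: ifPn => // rt; rewrite inE in rt.
  rewrite /G /ref_restrict patchE mem_set; last by apply/refP/T_ref.
  by rewrite tuple_of_rowK lee_fin; exact: T_del.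
by rewrite leNgt mule_gt0 ?lte_fin // ref_gt0.
Qed.

Lemma simplex_integral_sqr_eq0 d n (V : 'I_n.+1 -> 'rV[R]_d) g : polyfun g ->
  simplex_integral V (fun x => g x * g x) = 0 ->
  forall y, (forall k, 0 <= bary y k) -> g (simplex_point V y) = 0.
Proof. by move=> pg; apply: ref_sqr_eq0; exact: simplex_point_affine. Qed.

End vanishing.

(** * Polynomials of bounded degree *)

Section polynomials_on.
Context (R : realType) (d : nat).
Implicit Types (D : set 'rV[R]_d) (f g : 'rV[R]_d -> R).

Lemma poly_on_polyfun l D f : poly_on l D f ->
  exists2 g, polyfun g & forall x, D x -> f x = g x.
Proof. by move=> [p _ fp]; exists (fun x => mpoly.meval (fun i => x 0 i) p) => //; exists p. Qed.

Lemma poly_on_polyfunT l f : poly_on l setT f -> polyfun f.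
Proof. by move=> [p _ fp]; exists p => x; exact: fp. Qed.

Lemma poly_onS l D D' f : D `<=` D' -> poly_on l D' f -> poly_on l D f.
Proof. by move=> DD' [p sp fp]; exists p => // x /DD'; exact: fp. Qed.

Lemma poly_on0 l D : poly_on l D (fun _ => 0).
Proof. by exists 0 => [|x _]; rewrite ?mpoly.mmeasure0 ?mpoly.meval0. Qed.

Lemma poly_onD l D f g : poly_on l D f -> poly_on l D g ->
  poly_on l D (fun x => f x + g x).
Proof.
move=> [p sp fp] [q sq gq]; exists (p + q).
  by apply: leq_trans (mpoly.mmeasureD_le _ _ _) _; rewrite geq_max sp.
by move=> x Dx; rewrite mpoly.mevalD fp ?gq.
Qed.

Lemma poly_onZ l D c f : poly_on l D f -> poly_on l D (fun x => c * f x).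
Proof.
move=> [p sp fp]; exists (c *: p).
  by apply: leq_trans (mpoly.mmeasureZ_le _ _ _) _.
by move=> x Dx; rewrite mpoly.mevalZ fp.
Qed.

Lemma poly_on_sum l D I (r : seq I) (f : I -> 'rV[R]_d -> R) :
  (forall i, poly_on l D (f i)) -> poly_on l D (fun x => \sum_(i <- r) f i x).
Proof.
move=> pf; elim: r => [|i r IHr].
  by under eq_fun do rewrite big_nil; exact: poly_on0.
by under eq_fun do rewrite big_cons; exact: poly_onD.
Qed.

Lemma poly_on_dot l D (f : 'rV[R]_d -> 'rV[R]_d) c :
  vpoly_on l D f -> poly_on l D (fun x => dot (f x) c).
Proof.
move=> pf; apply: poly_on_sum => i; under eq_fun do rewrite mulrC.
exact: poly_onZ.
Qed.

Lemma poly_on_partial l f i : (0 < l)%N -> poly_on l setT f ->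
  poly_on l.-1 setT (partial i f).
Proof.
move=> l0 [p sp fp]; exists (mpoly.mderiv i p).
  rewrite prednK //; apply: leq_trans (mpoly.mmeasure_sum _ _ _ _) _.
  apply/bigmax_leqP_seq => m mp _.
  have [->|m0] := eqVneq (mpoly.fun_of_multinom m i) 0%N.
    by rewrite mul0r scale0r mpoly.mmeasure0.
  apply: leq_trans (mpoly.mmeasureZ_le _ _ _) _.
  rewrite mpoly.mmeasureX.
  have im := mpoly.lep1mP i m; rewrite m0 in im.
  rewrite -addn1 -(mpoly.mdeg1 i) -mpoly.mdegD (mpoly.submK im) -ltnS.
  exact: leq_trans (mpoly.msize_mdeg_lt mp) sp.
move=> x _; rewrite /partial -derive_meval; congr ('D_ _ _ _).
by apply/funext => y; exact: fp.
Qed.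

Lemma poly_on_divergence l (f : 'rV[R]_d -> 'rV[R]_d) : (0 < l)%N ->
  vpoly_on l setT f -> poly_on l.-1 setT (divergence f).
Proof. by move=> l0 pf; apply: poly_on_sum => i; exact: poly_on_partial. Qed.

End polynomials_on.

(** * Barycentric coordinates in a cell and shared facets *)

Section barycentric_coordinates.
Context (R : realType) (n : nat) (M : mesh R n.+1).
Implicit Types (A K F : simplex M).

(** The vector w expresses x as an affine combination of the vertices of A. *)
Definition weights A (w : 'I_(nvert M) -> R) (x : 'rV[R]_n.+1) :=
  [/\ forall i, i \notin A -> w i = 0, \sum_i w i = 1 & x = \sum_i w i *: vtx i].

Lemma hull_weights A w x : weights A w x -> (forall i, 0 <= w i) -> hull A x.
Proof. by move=> [wA w1 wx] w0; exists w. Qed.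

Lemma weights_sub A K w x : A \subset K -> weights A w x -> weights K w x.
Proof.
move=> /fintype.subsetP AK [wA w1 wx]; split=> // i iK; apply: wA.
by apply: contra iK => /AK.
Qed.

Definition vtx_weight (i j : 'I_(nvert M)) : R := (j == i)%:R.

Lemma weights_vtx A i : i \in A -> weights A (vtx_weight i) (vtx i).
Proof.
move=> iA; split.
- by move=> j jA; rewrite /vtx_weight; case: eqP jA => // ->; rewrite iA.
- rewrite (bigD1 i) //= /vtx_weight eqxx big1 ?addr0 // => j /negPf ji.
  by rewrite ji.
- rewrite (bigD1 i) //= /vtx_weight eqxx scale1r big1 ?addr0 // => j /negPf ji.
  by rewrite ji scale0r.
Qed.

Lemma weights_convex A (s : R) w w' x x' : weights A w x -> weights A w' x' ->
  weights A (fun i => (1 - s) * w i + s * w' i) ((1 - s) *: x + s *: x').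
Proof.
move=> [wA w1 wx] [wA' w1' wx']; split.
- by move=> i iA; rewrite wA // wA' // !mulr0 addr0.
- by rewrite big_split /= -!mulr_sumr w1 w1' !mulr1 subrK.
- rewrite wx wx' !scaler_sumr -big_split; apply: eq_bigr => i _ /=.
  by rewrite [RHS]scalerDl !scalerA.
Qed.

(** Barycentric coordinates with respect to K, indexed by all the vertices of the
    mesh and defined on the whole space. *)
Definition barycentric K (beta : 'rV[R]_n.+1 -> 'I_(nvert M) -> R) :=
  [/\ forall x, weights K (beta x) x,
      forall x w, weights K w x -> w =1 beta x &
      forall i, continuous (beta^~ i)].

Lemma barycentric_exists K : nondegenerate K -> exists beta, barycentric K beta.
Proof.
move=> ndK; have cK : #|K| = n.+2 by case: ndK.
have Vu := nondegenerate_unit cK ndK; set V := vertex_of K in Vu.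
have VE k : vtx (vidx cK k) = V k by rewrite /V (vertex_ofE cK).
pose y x := x *m invmx (edge_mx V) + - (V ord0 *m invmx (edge_mx V)).
have yE x : simplex_point V (y x) = x.
  by rewrite /simplex_point /y mulmxDl mulNmx !mulmxKV // subrK.
have yK z : y (simplex_point V z) = z.
  by rewrite /y /simplex_point mulmxDl mulmxK // addrK.
pose beta x i := \sum_(k | vidx cK k == i) bary (y x) k.
have bE x k : beta x (vidx cK k) = bary (y x) k.
  rewrite /beta (bigD1 k) //= big1 ?addr0 // => k' /andP[/eqP/vidx_inj ->].
  by rewrite eqxx.
have b0 x i : i \notin K -> beta x i = 0.
  move=> iA; rewrite /beta big_pred0 // => k; apply: contraNF iA => /eqP <-.
  exact: vidx_in.
exists beta; split=> [x|x w [wK w1 wx] i|i].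
- split; first exact: b0.
    rewrite (sum_vidx_supp cK); last exact: b0.
    by rewrite -[RHS](bary_sum (y x)); apply: eq_bigr => k _; rewrite bE.
  rewrite (sum_vidx_supp cK) => [|i iK]; last by rewrite b0 // scale0r.
  by rewrite -[LHS]yE simplex_pointE; apply: eq_bigr => k _; rewrite bE VE.
- have [/(vidx_onto cK)[k ->]|iK] := boolP (i \in K); last by rewrite wK // b0.
  pose z : 'rV[R]_n.+1 := \row_k w (vidx cK (lift ord0 k)).
  have zE k' : bary z k' = w (vidx cK k').
    case: (unliftP ord0 k') => [k'' ->|->]; first by rewrite baryS mxE.
    rewrite bary0 -w1 (sum_vidx_supp cK) // big_ord_recl.
    by under [X in _ - X]eq_bigr do rewrite mxE; rewrite addrK.
  suff -> : x = simplex_point V z by rewrite bE yK zE.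
  rewrite simplex_pointE wx (sum_vidx_supp cK) => [|j jK]; last by rewrite wK // scale0r.
  by apply: eq_bigr => k' _; rewrite zE VE.
- apply: polyfun_continuous; apply: polyfun_sum => k.
  apply: (@polyfun_affine _ _ _ _ _ (fun z => bary z k)).
  case: (unliftP ord0 k) => [k' ->|->].
    by under eq_fun do rewrite baryS; exact: polyfun_coord.
  under eq_fun do rewrite bary0.
  apply: polyfunD; first exact: polyfun_cst.
  by apply: polyfunN; apply: polyfun_sum => i'; exact: polyfun_coord.
Qed.

Lemma barycentric_vtx K beta i : barycentric K beta -> i \in K ->
  beta (vtx i) =1 vtx_weight i.
Proof. by move=> [_ bU _] iK j; rewrite -(bU _ _ (weights_vtx iK)). Qed.

Lemma barycentric_chain K1 K2 beta1 beta2 x l :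
  barycentric K1 beta1 -> barycentric K2 beta2 ->
  beta1 x l = \sum_i beta2 x i * beta1 (vtx i) l.
Proof.
move=> [b1 bU1 _] [b2 _ _]; have [_ w1 wx] := b2 x.
pose w l := \sum_i beta2 x i * beta1 (vtx i) l.
rewrite -/(w l) -(bU1 x w) //; split.
- move=> i iK; rewrite /w big1 // => j _; have [h _ _] := b1 (vtx j).
  by rewrite h // mulr0.
- rewrite /w exchange_big /= -w1; apply: eq_bigr => i _.
  by rewrite -mulr_sumr; have [_ -> _] := b1 (vtx i); rewrite mulr1.
- rewrite {1}wx /w; under [RHS]eq_bigr do rewrite scaler_suml.
  rewrite exchange_big /=; apply: eq_bigr => i _.
  have [_ _ {1}->] := b1 (vtx i).
  by rewrite scaler_sumr; apply: eq_bigr => j _; rewrite scalerA.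
Qed.

Section shared_facet.
Context (K1 K2 F : simplex M) (a1 a2 : 'I_(nvert M)).
Context (beta1 beta2 : 'rV[R]_n.+1 -> 'I_(nvert M) -> R).
Context (bK1 : barycentric K1 beta1) (bK2 : barycentric K2 beta2).
Context (K1E : K1 = a1 |: F) (K2E : K2 = a2 |: F).
Context (a1F : a1 \notin F) (a2F : a2 \notin F) (cF : #|F| = n.+1).

(** The coordinates of x at the apexes of two cells sharing F are proportional:
    both vanish on the hyperplane of F. *)
Lemma barycentric_apex x : beta1 x a1 = beta2 x a2 * beta1 (vtx a2) a1.
Proof.
rewrite (barycentric_chain x a1 bK1 bK2) (bigD1 a2) //= big1 ?addr0 // => i ia2.
have [iF|iF] := boolP (i \in F); last first.
  have [b2 _ _] := bK2; have [-> ] := b2 x; rewrite ?mul0r //.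
  by rewrite K2E !inE negb_or ia2.
rewrite (barycentric_vtx bK1); last by rewrite K1E !inE iF orbT.
rewrite /vtx_weight; have [a1i|] := eqVneq a1 i; last by rewrite mulr0.
by move: (a1F); rewrite a1i iF.
Qed.

(** The barycentre of F, where F is the common facet of K1 and K2. *)
Definition center_weight (i : 'I_(nvert M)) : R := if i \in F then n.+1%:R^-1 else 0.

Definition center : 'rV[R]_n.+1 := \sum_i center_weight i *: vtx i.

Lemma weights_center : weights F center_weight center.
Proof.
split=> //; first by move=> i iF; rewrite /center_weight (negPf iF).
rewrite -big_mkcond /= sumr_const cF -[LHS]mulr_natr mulVf // pnatr_eq0 //.
Qed.

Lemma center_hull : hull F center.
Proof.
by apply: hull_weights weights_center _ => i; rewrite /center_weight; case: ifP.
Qed.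

Let FK1 : F \subset K1. Proof. by rewrite K1E finset.subsetUr. Qed.
Let FK2 : F \subset K2. Proof. by rewrite K2E finset.subsetUr. Qed.

(** Otherwise the points near the centre of F in the direction of a2 would belong
    to both cells, although they are not in F. *)
Lemma opposite_sides : hull K1 `&` hull K2 = hull F -> beta1 (vtx a2) a1 < 0.
Proof.
move=> hF; rewrite ltNge; apply/negP => c0.
have [b1 bU1 _] := bK1; have [b2 bU2 _] := bK2.
pose c := beta1 (vtx a2).
pose C := \sum_i `|c i|; have C0 : 0 <= C by exact: sumr_ge0.
(* s is small enough for the weights of the point below to be non-negative *)
pose s := (1 + n.+1%:R * C)^-1.
have den0 : 0 < 1 + n.+1%:R * C by rewrite ltr_pwDl // mulr_ge0.
have s0 : 0 < s by rewrite invr_gt0.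
have sC : 1 - s = s * (n.+1%:R * C).
  rewrite -{1}(mulVf (lt0r_neq0 den0)) -/s mulrDr mulr1 addrC addKr //.
have s1 : 0 <= 1 - s by rewrite sC !mulr_ge0 // ltW.
pose x := (1 - s) *: center + s *: vtx a2.
have wc1 := weights_sub FK1 weights_center.
have wc2 := weights_sub FK2 weights_center.
have x1 : hull K1 x.
  apply: hull_weights (weights_convex s wc1 (b1 (vtx a2))) _ => i.
  rewrite /center_weight; case: ifPn => iF.
    have -> : (1 - s) * n.+1%:R^-1 + s * beta1 (vtx a2) i = s * (C + c i).
      by rewrite sC /c; field; rewrite addrC natr1 pnatr_eq0.
    rewrite mulr_ge0 ?(ltW s0) //.
    have : `|c i| <= C by rewrite /C (bigD1 i) //= lerDl sumr_ge0.
    by rewrite ler_norml => /andP[h _]; lra.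
  rewrite mulr0 add0r mulr_ge0 ?(ltW s0) //.
  have [->//|ia1] := eqVneq i a1.
  by have [-> //] := b1 (vtx a2); rewrite K1E !inE negb_or ia1.
have a2K : a2 \in K2 by rewrite K2E !inE eqxx.
have wx2 := weights_convex s wc2 (weights_vtx a2K).
have x2 : hull K2 x.
  apply: hull_weights wx2 _ => i; rewrite addr_ge0 ?mulr_ge0 ?(ltW s0) //.
  rewrite /center_weight; case: ifP => // _.
have : hull F x by rewrite -hF.
move=> [w [w0 wF w1 wx]].
have wK2 : weights K2 w x by apply: weights_sub FK2 _.
have := bU2 _ _ wK2 a2; rewrite -(bU2 _ _ wx2 a2) wF // /center_weight (negPf a2F).
rewrite mulr0 add0r /vtx_weight eqxx mulr1 => sz.
by move: s0; rewrite -sz ltxx.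
Qed.

Lemma center_interior : beta1 (vtx a2) a1 < 0 ->
  (hull K1 `|` hull K2)° center.
Proof.
move=> c0; have [b1 bU1 bc1] := bK1; have [b2 bU2 bc2] := bK2.
have bpos beta K : F \subset K -> barycentric K beta ->
    \forall x \near center, forall i, i \in F -> 0 < beta x i.
  move=> FK [bw bU bc].
  apply: (@filter_forall _ _ (fun i x => i \in F -> 0 < beta x i) _ (nbhs_filter center)) => i.
  have [iF|iF] := boolP (i \in F); last by apply: nearW => x h.
  have : 0 < beta center i.
    rewrite -(bU _ _ (weights_sub FK weights_center)) /center_weight iF.
    by rewrite invr_gt0 ltr0n.
  move/(cvgr_gt _ (bc i center)); apply: filterS => x h _; exact: h.
have H := @filterI _ _ (nbhs_filter center) _ _ (bpos _ _ FK1 bK1) (bpos _ _ FK2 bK2).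
apply: (@filterS _ _ (nbhs_filter center) _ _ _ H) => x [h1 h2].
have [s0|s0] := leP 0 (beta1 x a1).
  left; apply: hull_weights (b1 x) _ => i.
  have [iF|iF] := boolP (i \in F); first exact/ltW/h1.
  have [->//|ia1] := eqVneq i a1.
  by have [-> //] := b1 x; rewrite K1E !inE negb_or ia1.
right; apply: hull_weights (b2 x) _ => i.
have [iF|iF] := boolP (i \in F); first exact/ltW/h2.
have [->|ia2] := eqVneq i a2; last first.
  by have [-> //] := b2 x; rewrite K2E !inE negb_or ia2.
by move: s0; rewrite barycentric_apex nmulr_llt0 // => /ltW.
Qed.

End shared_facet.

Lemma hull_closed K : nondegenerate K -> closed (hull K).
Proof.
move=> /barycentric_exists[beta [bw bU bc]].
have -> : hull K = \bigcap_(i in [set: 'I_(nvert M)]) ((beta^~ i) @^-1` [set y | 0 <= y]).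
  apply/seteqP; split=> x.
    move=> [w [w0 wK w1 wx]] i _ /=.
    by rewrite -(bU x w) //; split.
  by move=> h; apply: hull_weights (bw x) _ => i; apply: h.
apply: closed_bigI => i _; apply: preimage_closed; last exact: closed_ge.
by move=> x _; exact: bc.
Qed.

Lemma covered_closed : (forall K, K \in cells M -> nondegenerate K) -> closed (covered M).
Proof.
move=> ndM; apply: closed_bigcup; first exact: finite_finset.
by move=> K /= KM; exact/hull_closed/ndM.
Qed.

End barycentric_coordinates.

(** Omega is the interior of a closed set, hence the interior of its closure. *)
Lemma polytopal_regular_open (R : realType) (n : nat) (Omega : set 'rV[R]_n.+1) :
  polytopal_domain Omega -> (closure Omega)° `<=` Omega°.
Proof.
move=> [_ _ [M [ndM OE]]].
have Oo : Omega° = Omega by apply/interior_id; rewrite OE; exact: open_interior.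
rewrite Oo {2}OE; apply: interiorS.
rewrite ((closure_id _).1 (covered_closed ndM)).
by apply: closureS; rewrite OE; exact: interior_subset.
Qed.

(** * Facets of a triangulation *)

Section facets_of_a_triangulation.
Context (R : realType) (n : nat) (Omega : set 'rV[R]_n.+1) (M : mesh R n.+1).
Context (M_tri : triangulates M Omega).
Implicit Types (K F : simplex M).

Lemma cell_nondegenerate K : K \in cells M -> nondegenerate K.
Proof. by case: M_tri => h _ _; exact: h. Qed.

Lemma card_cell K : K \in cells M -> #|K| = n.+2.
Proof. by move/cell_nondegenerate => []. Qed.

Lemma facet_apex K F : K \in cells M -> F \in facets_of K ->
  exists2 a, a \notin F & K = a |: F.
Proof.
move=> /card_cell cK /(facets_ofP cK F erefl)[j ->].
exists (vidx cK j); first by rewrite !inE eqxx.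
by rewrite finset.setD1K // vidx_in.
Qed.

Lemma facet_card K F : F \in facets_of K -> #|F| = n.+1.
Proof. by rewrite inE => /andP[_ /eqP]. Qed.

Lemma facet_shared K1 K2 F : K1 \in cells M -> K2 \in cells M -> K1 != K2 ->
  F \in facets_of K1 -> F \in facets_of K2 -> K1 :&: K2 = F.
Proof.
move=> K1M K2M K12 F1 F2; have cF := facet_card F1.
apply/esym/eqP; rewrite eqEcard cF.
have [FK1 FK2] : F \subset K1 /\ F \subset K2.
  by move: F1 F2; rewrite !inE => /andP[-> _] /andP[-> _].
rewrite finset.subsetI FK1 FK2 /= leqNgt; apply: contra K12 => h.
have E K : K \in cells M -> K1 :&: K2 \subset K -> K1 :&: K2 = K.
  by move=> KM sK; apply/eqP; rewrite eqEcard sK card_cell.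
by rewrite -{1}(E _ K1M (finset.subsetIl _ _)) (E _ K2M (finset.subsetIr _ _)).
Qed.

Lemma hull_shared K1 K2 F : K1 \in cells M -> K2 \in cells M -> K1 != K2 ->
  F \in facets_of K1 -> F \in facets_of K2 -> hull K1 `&` hull K2 = hull F.
Proof.
move=> K1M K2M K12 F1 F2; case: M_tri => _ _ -> //.
by rewrite (facet_shared K1M K2M K12 F1 F2).
Qed.

(** Among the apexes of three cells sharing F, two would lie on the same side. *)
Lemma facet_two_cells K1 K2 K3 F :
  K1 \in cells M -> K2 \in cells M -> K3 \in cells M ->
  F \in facets_of K1 -> F \in facets_of K2 -> F \in facets_of K3 ->
  K1 != K2 -> (K3 == K1) || (K3 == K2).
Proof.
move=> K1M K2M K3M F1 F2 F3 K12.
apply/negPn/negP; rewrite negb_or => /andP[K31 K32].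
have [a1 a1F K1E] := facet_apex K1M F1.
have [a2 a2F K2E] := facet_apex K2M F2.
have [a3 a3F K3E] := facet_apex K3M F3.
have [b1 bK1] := barycentric_exists (cell_nondegenerate K1M).
have [b2 bK2] := barycentric_exists (cell_nondegenerate K2M).
have [b3 bK3] := barycentric_exists (cell_nondegenerate K3M).
have cF := facet_card F1.
rewrite eq_sym in K31; rewrite eq_sym in K32.
have c12 := opposite_sides bK1 bK2 K1E K2E a2F cF (hull_shared K1M K2M K12 F1 F2).
have c13 := opposite_sides bK1 bK3 K1E K3E a3F cF (hull_shared K1M K3M K31 F1 F3).
have c23 := opposite_sides bK2 bK3 K2E K3E a3F cF (hull_shared K2M K3M K32 F2 F3).
have := barycentric_apex bK1 bK2 K1E K2E a1F (vtx a3) => E.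
by move: c13; rewrite E ltNge ltW // nmulr_rgt0.
Qed.

Lemma facet_shared_interior K1 K2 F : polytopal_domain Omega ->
  K1 \in cells M -> K2 \in cells M -> K1 != K2 ->
  F \in facets_of K1 -> F \in facets_of K2 -> F \notin boundary_facets M Omega.
Proof.
move=> domO K1M K2M K12 F1 F2.
have [a1 a1F K1E] := facet_apex K1M F1.
have [a2 a2F K2E] := facet_apex K2M F2.
have [b1 bK1] := barycentric_exists (cell_nondegenerate K1M).
have [b2 bK2] := barycentric_exists (cell_nondegenerate K2M).
have cF := facet_card F1.
have c12 := opposite_sides bK1 bK2 K1E K2E a2F cF (hull_shared K1M K2M K12 F1 F2).
have ci := center_interior bK1 bK2 K1E K2E a1F cF c12.
apply/negP; rewrite inE => /andP[_ /asboolP/(_ _ (center_hull cF))[_]].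
apply; apply: (polytopal_regular_open domO).
case: M_tri => _ -> _; apply: interiorS ci => x [h|h]; [exists K1|exists K2] => //.
Qed.

End facets_of_a_triangulation.

(** * Integrals over facets *)

Section facet_integrals.
Context (R : realType) (n : nat) (M : mesh R n.+1).
Implicit Types (K F : simplex M).

Lemma facet_integral0 F G : facet_integral F G (fun _ => 0) = 0.
Proof. by rewrite /facet_integral /Rintegral integral0 mulr0. Qed.

Lemma eq_facet_integral F f g : #|F| = n.+1 -> (forall x, hull F x -> f x = g x) ->
  facet_integral F setT f = facet_integral F setT g.
Proof.
move=> cF fg; rewrite !facet_integralE; congr (_ * _).
apply: eq_Rintegral => t /set_mem /ref_bary ht; apply: fg.
by apply/(hullP cF); exists (vec_of t).
Qed.

(** The function f coincides on D with a polynomial function. *)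
Definition polyfun_on d (D : set 'rV[R]_d) (f : 'rV[R]_d -> R) :=
  exists2 g, polyfun g & forall x, D x -> f x = g x.

Lemma polyfun_onM d (D : set 'rV[R]_d) f g :
  polyfun_on D f -> polyfun_on D g -> polyfun_on D (fun x => f x * g x).
Proof.
move=> [f' pf ff'] [g' pg gg']; exists (fun x => f' x * g' x); first exact: polyfunM.
by move=> x Dx; rewrite ff' ?gg'.
Qed.

Lemma facet_integralD F f g : #|F| = n.+1 ->
  polyfun_on (hull F) f -> polyfun_on (hull F) g ->
  facet_integral F setT (fun x => f x + g x) =
  facet_integral F setT f + facet_integral F setT g.
Proof.
move=> cF [f' pf ff'] [g' pg gg'].
rewrite (eq_facet_integral cF ff') (eq_facet_integral cF gg').
rewrite (@eq_facet_integral _ _ (fun x => f' x + g' x)) //; last first.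
  by move=> x hx; rewrite ff' ?gg'.
by rewrite !facet_integralE simplex_integralD // mulrDr.
Qed.

Lemma facet_integral_sqr_eq0 l K F g : nondegenerate K -> F \in facets_of K ->
  poly_on l (hull F) g -> facet_integral F setT (fun x => g x * g x) = 0 ->
  forall x, hull F x -> g x = 0.
Proof.
move=> ndK FK /poly_on_polyfun[g' pg gg'].
have cF := facet_card FK; have cK : #|K| = n.+2 by case: ndK.
have Vu := nondegenerate_unit cK ndK.
rewrite (@eq_facet_integral _ _ (fun x => g' x * g' x)) //; last first.
  by move=> x hx; rewrite gg'.
have [j Fj] : exists j, F = K :\ vidx cK j by apply/facets_ofP.
rewrite facet_integralE.
have VE : @vertex_of _ _ M n F = vertex_of K \o lift j.
  by rewrite Fj; apply/funext => k; exact: vertex_of_facet.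
move/eqP; rewrite mulf_eq0 sqrtr_eq0 leNgt {1 2}VE gram_facet // mulr_gt0 /=; last 2 first.
- by rewrite exprn_even_gt0 //= -unitfE -unitmxE.
- by rewrite lt_def dot_ge0 andbT dot_eq0 bary_grad_neq0.
move/eqP => I0 x /[dup] hx /(hullP cF)[y y0 xE].
by rewrite gg' // xE; exact: simplex_integral_sqr_eq0 I0 _ y0.
Qed.

End facet_integrals.

(** * Consequences of the mass balances *)

Section mass_balance.
Context (R : realType) (n : nat) (Omega : set 'rV[R]_n.+1) (M : mesh R n.+1).
Context (k : nat) (u ubar : vector_field M).
Context (Omega_domain : polytopal_domain Omega) (M_tri : triangulates M Omega).
Implicit Types (K F : simplex M).

Lemma grad0 d (x : 'rV[R]_d) : grad (fun _ => 0) x = 0.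
Proof. by apply/rowP => j; rewrite !mxE /partial derive_cst. Qed.

Lemma divergence_free : (1 < k)%N -> Vh k u -> mass_balance_cells k u ->
  forall K, K \in cells M -> forall x, hull K x -> divergence (u K) x = 0.
Proof.
move=> k1 uV mb K KM; have ndK := cell_nondegenerate M_tri KM.
have cK : #|K| = n.+2 by case: ndK.
have uK := uV _ KM.
pose D := divergence (u K).
have pD : poly_on k.-1 setT D by apply: poly_on_divergence => //; exact: ltnW.
have fD := poly_on_polyfunT pD.
have fu i : polyfun (fun x => u K x 0 i) by apply: poly_on_polyfunT (uK i).
pose q : scalar_field M := fun K' => if K' == K then D else fun _ => 0.
have qQ : Qh k q.
  by move=> K' _; rewrite /q; case: eqP => // _; exact: poly_on0.
have qK : q K = D by rewrite /q eqxx.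
have q0 K' : K' != K -> q K' = fun _ => 0 by rewrite /q => /negPf ->.
have := mb q qQ; rewrite /sum_cells /sum_cell_boundaries.
rewrite (bigD1 K) //= [X in _ + X - _]big1 ?addr0; last first.
  move=> K' /andP[_ /q0 ->]; rewrite /volume_integral /Rintegral.
  rewrite integral0_eq // => t _; congr (_%:E).
  by rewrite grad0 dotC /dot big1 // => i _; rewrite mxE mul0r.
rewrite (bigD1 K) //= [X in _ - (_ + X)]big1 ?addr0; last first.
  move=> K' /andP[_ /q0 ->]; apply: big1 => F _.
  by under eq_fun do rewrite mulr0; exact: facet_integral0.
rewrite qK => mbK.
pose w i (x : 'rV[R]_n.+1) := u K x 0 i * D x.
have fw i : polyfun (w i) by exact: polyfunM.
have := divergence_theorem ndK fw.
have -> : (fun x => \sum_i 'D_(delta_mx 0 i) (w i) x) =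
   (fun x => dot (u K x) (grad D x) + D x * D x).
  apply/funext => x; rewrite /dot /D /divergence mulr_suml -big_split /=.
  apply: eq_bigr => i _; rewrite /w -/(divergence (u K)) -/D.
  have du := (polyfun_derive (delta_mx 0 i) (fu i)).1 x.
  have dD := (polyfun_derive (delta_mx 0 i) fD).1 x.
  by rewrite (deriveM du dD) mxE /GRing.scale /= [X in _ + X]mulrC.
have fg : polyfun (fun x => dot (u K x) (grad D x)).
  apply: polyfun_sum => i; apply: polyfunM => //.
  under eq_fun do rewrite mxE; exact: (polyfun_derive _ fD).2.
rewrite volume_integralE //; last by apply: polyfunD => //; exact: polyfunM.
rewrite simplex_integralD //; last exact: polyfunM.
rewrite mulrDr -volume_integralE //.
have -> : \sum_(F in facets_of K) facet_integral F setT (row_fun w (normal K F)) =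
   \sum_(F in facets_of K) facet_integral F setT (fun x => dot (u K x) (normal K F) * D x).
  apply: eq_bigr => F _; congr facet_integral; apply/funext => x.
  by rewrite /row_fun /dot mulr_suml; apply: eq_bigr => i _; rewrite /w mulrAC.
move=> DT; have I0 : `|\det (edge_mx (@vertex_of _ _ M n.+1 K))| *
    simplex_integral (@vertex_of _ _ M n.+1 K) (fun x => D x * D x) = 0.
  by move: mbK; rewrite -DT opprD addrA subrr sub0r => /esym/eqP; rewrite oppr_eq0 => /eqP.
have dK : `|\det (edge_mx (@vertex_of _ _ M n.+1 K))| != 0.
  by rewrite normr_eq0 -unitfE -unitmxE; exact: nondegenerate_unit.
move/eqP: I0; rewrite mulf_eq0 (negPf dK) /= => /eqP I0 x /(hullP cK)[y y0 ->].
exact: simplex_integral_sqr_eq0 I0 _ y0.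
Qed.

Context (uV : Vh k u) (mb : mass_balance_facets Omega k u ubar).

Lemma poly_on_trace K F c : K \in cells M ->
  poly_on k (hull F) (fun x => dot (u K x) c).
Proof. by move=> KM; apply: poly_on_dot => i; apply: poly_onS (uV KM i). Qed.

(** The mass balance tested with a function supported on the facet F. *)
Lemma mass_balance_facet F g : poly_on k (hull F) g ->
  \sum_(K in cells M | F \in facets_of K)
    facet_integral F setT (fun x => dot (u K x) (normal K F) * g x) =
  \sum_(K in cells M | (F \in facets_of K) && (F \in boundary_facets M Omega))
    facet_integral F setT (fun x => dot (ubar F x) (normal K F) * g x).
Proof.
move=> pg; pose q : scalar_field M := fun F' => if F' == F then g else fun _ => 0.
have qQ : Qbarh Omega k q.
  move=> F' _; rewrite /q; case: eqP => [->//|_]; exact: poly_on0.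
have q0 F' : F' != F -> q F' = fun _ => 0 by rewrite /q => /negPf ->.
have qF : q F = g by rewrite /q eqxx.
have S (v : simplex M -> simplex M -> 'rV[R]_n.+1 -> R) K (A : {set simplex M}) :
    \sum_(F' in A) facet_integral F' setT (fun x => v K F' x * q F' x) =
    if F \in A then facet_integral F setT (fun x => v K F x * g x) else 0.
  have [FA|FA] := boolP (F \in A).
    rewrite (bigD1 F) //= qF [X in _ + X]big1 ?addr0 // => F' /andP[_ /q0 ->].
    by under eq_fun do rewrite mulr0; exact: facet_integral0.
  rewrite big1 // => F' F'A; rewrite q0; last by apply: contraNneq FA => <-.
  by under eq_fun do rewrite mulr0; exact: facet_integral0.
have := mb qQ; rewrite /sum_cell_boundaries /boundary_integral => /eqP.
rewrite eq_sym subr_eq0 => /eqP.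
under eq_bigr do rewrite (S (fun K F x => dot (u K x) (normal K F))).
under [X in _ = X -> _]eq_bigr do rewrite (S (fun K F x => dot (ubar F x) (normal K F))).
rewrite -!big_mkcondr /= => ->.
by apply: eq_bigl => K; rewrite inE.
Qed.

(** The sum over the cells containing F has two terms and no boundary term; with
    the jump itself as test function it is the integral of the squared jump. *)
Lemma normal_continuous Kp Km F : Kp \in cells M -> Km \in cells M -> Kp != Km ->
  F \in facets_of Kp -> F \in facets_of Km ->
  forall x, hull F x ->
  dot (u Kp x) (normal Kp F) + dot (u Km x) (normal Km F) = 0.
Proof.
move=> KpM KmM Kpm Fp Fm.
have cF := facet_card Fp.
pose g x := dot (u Kp x) (normal Kp F) + dot (u Km x) (normal Km F).
have pp := poly_on_trace F (normal Kp F) KpM.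
have pm := poly_on_trace F (normal Km F) KmM.
have pg : poly_on k (hull F) g by exact: poly_onD.
have := mass_balance_facet pg.
have FnB := facet_shared_interior M_tri Omega_domain KpM KmM Kpm Fp Fm.
rewrite [RHS]big_pred0; last by move=> K; rewrite (negPf FnB) !andbF.
rewrite (bigD1 Kp) ?KpM //= (bigD1 Km) ?KmM ?Fm 1?eq_sym //=.
rewrite [X in _ + (_ + X)]big1 ?addr0; last first.
  move=> K /andP[/andP[/andP[KM FK] nKp] nKm].
  have := facet_two_cells M_tri KpM KmM KM Fp Fm FK Kpm.
  by rewrite (negPf nKp) (negPf nKm).
have fg : polyfun_on (hull F) g by exact: poly_on_polyfun pg.
have fp := polyfun_onM (poly_on_polyfun pp) fg.
have fm := polyfun_onM (poly_on_polyfun pm) fg.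
rewrite -(facet_integralD cF fp fm).
under eq_fun do rewrite -mulrDl -/(g _).
move=> I0; exact: (facet_integral_sqr_eq0 (cell_nondegenerate M_tri KpM) Fp pg I0).
Qed.

(** F belongs to no other cell, as it would then not be a boundary facet. *)
Lemma boundary_trace K F : vpoly_on k (hull F) (ubar F) ->
  K \in cells M -> F \in facets_of K -> F \in boundary_facets M Omega ->
  forall x, hull F x -> dot (u K x) (normal K F) = dot (ubar F x) (normal K F).
Proof.
move=> ubF KM FK FB; have cF := facet_card FK.
pose g x := dot (u K x) (normal K F) + -1 * dot (ubar F x) (normal K F).
have pu := poly_on_trace F (normal K F) KM.
have pb : poly_on k (hull F) (fun x => dot (ubar F x) (normal K F)) by exact: poly_on_dot.
have pg : poly_on k (hull F) g by apply: poly_onD => //; exact: poly_onZ.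
have only_K K' : K' \in cells M -> F \in facets_of K' -> K' = K.
  move=> KM' FK'; apply: contraTeq FB => KK'.
  exact: (facet_shared_interior M_tri Omega_domain KM' KM).
have := mass_balance_facet pg.
rewrite (big_pred1 K) => [|K']; last first.
  by apply/andP/eqP => [[KM' FK']|->]; [exact: only_K|].
rewrite (big_pred1 K) => [|K']; last first.
  apply/andP/eqP => [[KM' /andP[FK' _]]|->]; [exact: only_K|by rewrite KM FK FB].
have fg : polyfun_on (hull F) g by exact: poly_on_polyfun pg.
have fu := polyfun_onM (poly_on_polyfun pu) fg.
have fb := polyfun_onM (poly_on_polyfun (poly_onZ (-1) pb)) fg.
move=> I0 x hx; apply/eqP; rewrite -subr_eq0 -mulN1r; apply/eqP.
apply: (facet_integral_sqr_eq0 (cell_nondegenerate M_tri KM) FK pg) x hx.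
transitivity (facet_integral F setT (fun x => dot (u K x) (normal K F) * g x +
    -1 * dot (ubar F x) (normal K F) * g x)).
  by congr facet_integral; apply/funext => x; rewrite -mulrDl.
rewrite facet_integralD // I0 -facet_integralD //; last first.
  exact: polyfun_onM (poly_on_polyfun pb) fg.
rewrite -[RHS](facet_integral0 F setT); congr facet_integral; apply/funext => x.
by rewrite mulN1r mulNr subrr.
Qed.

End mass_balance.

Theorem proposition1 (R : realType) (d : nat) (d_23 : d = 2%N \/ d = 3%N)
  (Omega GammaD GammaN : set 'rV[R]_d)
  (Omega_domain : polytopal_domain Omega)
  (Gamma_cover : boundary Omega = GammaD `|` GammaN)
  (Gamma_disj : GammaD `&` GammaN = set0)
  (M : mesh R d) (M_tri : triangulates M Omega)
  (k : nat) (k_ge2 : (2 <= k)%N)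
  (nu alpha tN : R) (nu_gt0 : 0 < nu) (alpha_gt0 : 0 < alpha) (tN_gt0 : 0 < tN)
  (f h : R -> 'rV[R]_d -> 'rV[R]_d)
  (f_L2 : forall t, t \in `]0, tN] ->
     forall i, square_integrable Omega (fun x => f t x 0 i))
  (h_L2 : forall t, t \in `]0, tN] ->
     forall F, F \in boundary_facets M Omega ->
     forall i, facet_square_integrable F GammaN (fun x => h t x 0 i))
  (u ubar : R -> vector_field M) (p pbar : R -> scalar_field M)
  (sol : semidiscrete_solution Omega GammaD GammaN k nu alpha
           [set` `]0, tN]] f h u ubar p pbar) :
  forall t, t \in `]0, tN] ->
  [/\ forall K, K \in cells M ->
        forall x, hull K x -> divergence (u t K) x = 0,
      forall Kp Km, Kp \in cells M -> Km \in cells M -> Kp != Km ->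
        Kp :&: Km \in interior_facets M ->
        forall x, hull (Kp :&: Km) x -> jump (u t) Kp Km x = 0 &
      forall K F, K \in cells M -> F \in facets_of K ->
        F \in boundary_facets M Omega ->
        forall x, hull F x ->
        dot (u t K x) (normal K F) = dot (ubar t F x) (normal K F)].
Proof.
have [n dn] : exists n, d = n.+1 by case: d_23 => ->; [exists 1%N|exists 2%N].
subst d => t tI; have [[uV [ubV _] _ _] _ mbc mbf _] := sol t tI.
split.
- exact: (divergence_free M_tri k_ge2 uV mbc).
- move=> Kp Km KpM KmM Kpm; rewrite inE => /existsP[K1 /andP[K1M /existsP[K2]]].
  case/and3P => _ _ /andP[_ /eqP cF].
  apply: (normal_continuous Omega_domain M_tri uV mbf KpM KmM Kpm).
  + by rewrite inE finset.subsetIl cF /=.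
  + by rewrite inE finset.subsetIr cF /=.
- move=> K F KM FK FB.
  apply: (boundary_trace Omega_domain M_tri uV mbf _ KM FK FB).
  by apply: ubV; rewrite inE FB orbT.
Qed.
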